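(* Let $m$ be a positive integer, let $1\le k\le m$, and let $\mathcal{I}=\{I_1,\ldots,I_k\}$ be a family of pairwise disjoint non-void subsets of $\{1,\ldots,m\}$ such that $\bigcup_{j=1}^k I_j=\{1,\ldots,m\}$. Let $n=\min\{|I_1|,\ldots,|I_k|\}$. Then $$\mathcal{L}(^m\ell_1;\ell_2)=\mathcal{L}_{\mathcal{I},as\left(\frac{2}{n+1};1\right)}(^m\ell_1;\ell_2),$$ and the result is optimal; that is, for every real $r$ with $0<r<\frac{2}{n+1}$ one has $\mathcal{L}(^m\ell_1;\ell_2)\neq\mathcal{L}_{\mathcal{I},as(r;1)}(^m\ell_1;\ell_2)$.
   Context: All Banach spaces are over $\mathbb{K}=\mathbb{R}$ or $\mathbb{C}$. $\mathcal{L}(^mE;F)$ is the space of all bounded $m$-linear operators $E\times\cdots\times E\to F$. For a Banach space $E$ with closed dual unit ball $B_{E^*}$, $\ell_1^w(E)$ is the space of sequences $(x_j)_{j=1}^\infty$ in $E$ with $\sup_{\varphi\in B_{E^*}}\sum_{j=1}^\infty|\varphi(x_j)|<\infty$. For a partition $\mathcal{I}=\{I_1,\ldots,I_k\}$ of $\{1,\ldots,m\}$ into non-void sets, $\Omega_{\mathcal{I}}\subset\mathbb{N}^m$ is the product of diagonals $\mathrm{Diag}(\mathbb{N}^{|I_1|})\times\cdots\times\mathrm{Diag}(\mathbb{N}^{|I_k|})$, where the factor for $I_i$ occupies the coordinates indexed by $I_i$; that is, $\Omega_{\mathcal{I}}$ is the set of $(j_1,\ldots,j_m)\in\mathbb{N}^m$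 with $j_a=j_b$ whenever $a,b$ belong to the same block $I_i$. For $r\in(0,\infty)$ and a Banach space $F$, $\mathcal{L}_{\mathcal{I},as(r;1)}(^m\ell_1;F)$ is the space of all $T\in\mathcal{L}(^m\ell_1;F)$ such that $\sum_{(j_1,\ldots,j_m)\in\Omega_{\mathcal{I}}}\|T(x^{(1)}_{j_1},\ldots,x^{(m)}_{j_m})\|_F^r<\infty$ whenever $(x^{(i)}_{j})_{j=1}^\infty\in\ell_1^w(\ell_1)$ for $i=1,\ldots,m$. *)

(* Defs.v *)
From HB Require Import structures.
From mathcomp Require Import all_boot all_order all_algebra.
From mathcomp Require Import complex.
From mathcomp Require Import all_classical all_reals all_analysis.

Set Implicit Arguments.
Unset Strict Implicit.
Unset Printing Implicit Defensive.

Import Order.TTheory GRing.Theory Num.Theory.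
Import numFieldNormedType.Exports.

Local Open Scope classical_set_scope.
Local Open Scope ring_scope.

(* The scalar field is one of the two fields [R] and [R[i]].  MathComp norms
   take their values in the scalar field, so [real_norm] is used to read them
   as elements of [R]. *)
Variant scalar_kind := RealScalars | ComplexScalars.

Definition scalar (R : realType) (s : scalar_kind) : numFieldType :=
  match s with
  | RealScalars => R
  | ComplexScalars => R[i]
  end.

Definition real_part (R : realType) (s : scalar_kind) : scalar R s -> R :=
  match s return scalar R s -> R with
  | RealScalars => fun a => a
  | ComplexScalars => fun a => complex.Re a
  end.

Definition of_real (R : realType) (s : scalar_kind) : R -> scalar R s :=
  match s return R -> scalar R s with
  | RealScalars => fun a => a
  | ComplexScalars => fun a => a%:C%C
  end.

Definition real_norm (R : realType) (s : scalar_kind)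
    (V : normedZmodType (scalar R s)) (v : V) : R := real_part `|v|.

Section real_norm_theory.
Context {R : realType} {s : scalar_kind}.

Lemma of_realK (a : R) : real_part (of_real s a) = a.
Proof. by case: s. Qed.

Lemma of_realD (a b : R) : of_real s (a + b) = of_real s a + of_real s b.
Proof. by case: s => //=; rewrite rmorphD. Qed.

Lemma of_realM (a b : R) : of_real s (a * b) = of_real s a * of_real s b.
Proof. by case: s => //=; rewrite rmorphM. Qed.

Lemma ler_of_real (a b : R) : (of_real s a <= of_real s b) = (a <= b).
Proof. by case: s => //=; rewrite lecR. Qed.

Lemma real_normK (V : normedZmodType (scalar R s)) (v : V) :
  of_real s (real_norm v) = `|v|.
Proof.
rewrite /real_norm; move: (normr_ge0 v); move: `|v| => a.
by case: s a => //= a a0; apply: RRe_real; exact: ger0_real.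
Qed.

Lemma real_norm_ge0 (V : normedZmodType (scalar R s)) (v : V) :
  0 <= real_norm v.
Proof.
rewrite -ler_of_real real_normK.
by have -> : of_real s 0 = 0 by case: s.
Qed.

Lemma real_normD (V : normedZmodType (scalar R s)) (v w : V) :
  real_norm (v + w) <= real_norm v + real_norm w.
Proof. by rewrite -ler_of_real of_realD !real_normK ler_normD. Qed.

Lemma real_norm0 (V : normedZmodType (scalar R s)) : real_norm (0 : V) = 0.
Proof. by rewrite /real_norm normr0; case: s. Qed.

Lemma real_norm0_eq0 (V : normedZmodType (scalar R s)) (v : V) :
  real_norm v = 0 -> v = 0.
Proof.
move=> v0; apply/normr0_eq0; rewrite -real_normK v0.
by case: s.
Qed.

Lemma real_normM (a b : scalar R s) :
  real_norm (a * b) = real_norm a * real_norm b.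
Proof.
by rewrite -[LHS]of_realK -[RHS]of_realK of_realM !real_normK normrM.
Qed.

End real_norm_theory.

(* These are locked because unification would otherwise try to unfold limits
   and real powers. *)
HB.lock Definition lp_sum (R : realType) (s : scalar_kind) (p : R)
    (x : nat -> scalar R s) : \bar R :=
  (\sum_(0 <= j <oo) (real_norm (x j) `^ p)%:E)%E.
Canonical locked_lp_sum := Unlockable lp_sum.unlock.
Arguments lp_sum {R s} p x.

HB.lock Definition lp_norm (R : realType) (s : scalar_kind) (p : R)
    (x : nat -> scalar R s) : R :=
  fine (lp_sum p x) `^ p^-1.
Canonical locked_lp_norm := Unlockable lp_norm.unlock.
Arguments lp_norm {R s} p x.

Section lp.
Context (R : realType) (s : scalar_kind).
Local Notation K := (scalar R s).
Local Open Scope ereal_scope.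

Definition lp_seq (p : R) (p1 : (1 <= p)%R) : {pred nat -> K} :=
  fun x => `[< lp_sum p x < +oo >].

Lemma lp_sum_ge0 p (x : nat -> K) : 0 <= lp_sum p x.
Proof.
by rewrite unlock; apply: nneseries_ge0 => j _ _; rewrite lee_fin powR_ge0.
Qed.

Lemma Lnorm_real_norm p (f : nat -> R) : (0 < p)%R -> (forall j, 0 <= f j)%R ->
  Lnorm counting p%:E (EFin \o f) =
  (\sum_(0 <= j <oo) (f j `^ p)%:E) `^ p^-1.
Proof.
move=> p0 f0; rewrite Lnorm_counting//; congr (_ `^ _).
by apply: eq_eseriesr => j _ /=; rewrite ger0_norm ?poweR_EFin.
Qed.

Lemma lp_minkowski p (x y : nat -> K) : (1 <= p)%R ->
  lp_sum p (x + y)%R `^ p^-1 <= lp_sum p x `^ p^-1 + lp_sum p y `^ p^-1.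
Proof.
move=> p1; have p0 : (0 < p)%R by exact: lt_le_trans p1.
rewrite unlock.
have := @minkowski_EFin _ _ R counting (fun j => real_norm (x j))
  (fun j => real_norm (y j)) p.
have mf : forall f : nat -> R, measurable_fun setT f by [].
move=> /(_ (mf _) (mf _) p1).
rewrite !Lnorm_real_norm//; last 3 first.
- by move=> j; rewrite ?addr_ge0 ?real_norm_ge0.
- by move=> j; rewrite ?addr_ge0 ?real_norm_ge0.
- by move=> j; rewrite ?addr_ge0 ?real_norm_ge0.
apply: le_trans.
apply: gt0_ler_poweR => //.
- by rewrite invr_ge0 ltW.
- rewrite in_itv/= leey andbT.
  by apply: nneseries_ge0 => j _ _; rewrite lee_fin powR_ge0.
- rewrite in_itv/= leey andbT.
  by apply: nneseries_ge0 => j _ _; rewrite lee_fin powR_ge0.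
apply: lee_nneseries => j _; first by move=> _; rewrite lee_fin powR_ge0.
rewrite lee_fin ge0_ler_powR ?nnegrE ?real_norm_ge0 ?addr_ge0 ?real_norm_ge0//.
- exact: ltW.
- exact: real_normD.
Qed.

Lemma lp_sumZ p (a : K) (x : nat -> K) :
  lp_sum p (a *: x)%R = (real_norm a `^ p)%:E * lp_sum p x.
Proof.
rewrite unlock -nneseriesZl; last by move=> j _; rewrite lee_fin powR_ge0.
apply: eq_eseriesr => j _.
by rewrite -EFinM -powRM ?real_norm_ge0// -real_normM.
Qed.

Lemma lp_seq_submod p (p1 : (1 <= p)%R) : submod_closed (lp_seq p1).
Proof.
have p0 : (0 < p)%R by exact: lt_le_trans p1.
split.
  apply/asboolP; rewrite unlock eseries0 ?ltry// => j _ _.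
  by rewrite real_norm0 powR0// gt_eqF.
move=> a x y /asboolP xp /asboolP yp; apply/asboolP.
have axp : lp_sum p (a *: x)%R < +oo.
  by rewrite lp_sumZ lte_mul_pinfty// lee_fin powR_ge0.
have axyp := le_lt_trans (lp_minkowski (a *: x)%R y p1)
  (lte_add_pinfty (poweR_lty _ axp) (poweR_lty _ yp)).
by apply: lty_poweRy axyp; rewrite invr_neq0// gt_eqF.
Qed.

HB.instance Definition _ p (p1 : (1 <= p)%R) :=
  GRing.isSubmodClosed.Build K (nat -> K) (lp_seq p1) (lp_seq_submod p1).

Record lp (p : R) (p1 : (1 <= p)%R) :=
  Lp { lp_fun :> nat -> K ; lp_funP : lp_fun \in lp_seq p1 }.

HB.instance Definition _ p (p1 : (1 <= p)%R) := [isSub for @lp_fun p p1].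
HB.instance Definition _ p (p1 : (1 <= p)%R) := [Choice of lp p1 by <:].
HB.instance Definition _ p (p1 : (1 <= p)%R) :=
  [SubChoice_isSubLmodule of lp p1 by <:].

End lp.

Section lp_normed.
Context (R : realType) (s : scalar_kind) (p : R) (p1 : 1 <= p).
Local Notation K := (scalar R s).
Implicit Types x y : lp s p1.

Let p0 : 0 < p. Proof. exact: lt_le_trans p1. Qed.

Lemma lp_normE x : (lp_norm p x)%:E = (lp_sum p x `^ p^-1)%E.
Proof.
rewrite unlock -poweR_EFin fineK// ge0_fin_numE ?lp_sum_ge0//.
exact/asboolP/(lp_funP x).
Qed.

Lemma lp_normD x y : lp_norm p (x + y : lp s p1) <= lp_norm p x + lp_norm p y.
Proof.
rewrite -lee_fin EFinD.
rewrite !lp_normE.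
exact: (lp_minkowski (lp_fun x) (lp_fun y)).
Qed.

Lemma lp_normZ (a : K) x :
  lp_norm p (a *: x : lp s p1) = real_norm a * lp_norm p x.
Proof.
apply: EFin_inj; rewrite EFinM !lp_normE.
have -> : lp_sum p (a *: x : lp s p1) = lp_sum p (a *: lp_fun x) by [].
rewrite lp_sumZ poweRM ?lp_sum_ge0 ?lee_fin ?powR_ge0// poweR_EFin.
by rewrite -powRrM mulfV ?gt_eqF// powRr1// real_norm_ge0.
Qed.

Let norm x : K := of_real s (lp_norm p x).

Let ler_normD x y : norm (x + y : lp s p1) <= norm x + norm y.
Proof.
rewrite /norm -(of_realD (lp_norm p x) (lp_norm p y)) ler_of_real.
exact: lp_normD.
Qed.

Let normrZ (a : K) x : norm (a *: x : lp s p1) = `|a| * norm x.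
Proof. by rewrite /norm -(real_normK a) -of_realM lp_normZ. Qed.

Let normr0_eq0 x : norm x = 0 -> x = 0.
Proof.
move=> x0; have {}x0 : lp_norm p x = 0.
  by rewrite -(@of_realK R s (lp_norm p x)) -/(norm x) x0; case: (s).
have /poweR_eq0_eq0 {}x0 : (lp_sum p x `^ p^-1)%E = 0%E.
  by rewrite -lp_normE x0.
apply: val_inj; apply/funext => j /=.
apply: real_norm0_eq0; apply: (@powR_eq0_eq0 _ _ p).
have : ((real_norm (lp_fun x j) `^ p)%:E <= lp_sum p x)%E.
  rewrite unlock (nneseries_split _ j.+1); last first.
    by move=> i _; rewrite lee_fin powR_ge0.
  rewrite add0n big_nat_recr//= -addeA addeCA leeDl//.
  rewrite adde_ge0//; first by apply: sume_ge0 => i _; rewrite lee_fin powR_ge0.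
  by apply: nneseries_ge0 => i _ _; rewrite lee_fin powR_ge0.
rewrite x0 ?lp_sum_ge0// lee_fin => xj0.
by apply/le_anti; rewrite xj0 powR_ge0.
Qed.

HB.instance Definition _ := Lmodule_isNormed.Build K (lp s p1)
  ler_normD normrZ normr0_eq0.

Lemma real_norm_lp x : real_norm x = lp_norm p x.
Proof. exact: of_realK. Qed.

End lp_normed.

Definition l1 (R : realType) (s : scalar_kind) : normedModType (scalar R s) :=
  lp s (lexx (1 : R)).

Definition l2 (R : realType) (s : scalar_kind) : normedModType (scalar R s) :=
  lp s (ler1n R 2).

Section spaces_of_operators.
Context (R : realType) (s : scalar_kind).
Local Notation K := (scalar R s).

Definition dual_unit_ball (E : normedModType K) : set {linear E -> K^o} :=
  [set phi | forall v, real_norm (phi v) <= real_norm v].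

Definition weakly_summable (E : normedModType K) (x : nat -> E) : Prop :=
  (ereal_sup [set \sum_(0 <= j <oo) (real_norm (phi (x j)))%:E
             | phi in @dual_unit_ball E] < +oo)%E.

Definition multilinear (m : nat) (E F : normedModType K)
    (T : ('I_m -> E) -> F) : Prop :=
  forall (v : 'I_m -> E) (i : 'I_m), linear (fun u : E => T (dfwith v i u)).

Definition bounded_multilinear (m : nat) (E F : normedModType K) :
    set (('I_m -> E) -> F) :=
  [set T | multilinear T /\
     exists C : R, forall v, real_norm (T v) <= C * \prod_i real_norm (v i)].

Definition Omega (m k : nat) (I : 'I_k -> {set 'I_m}) :
    set {ffun 'I_m -> nat} :=
  [set j | forall l a b, a \in I l -> b \in I l -> j a = j b].

Definition abs_summing (m k : nat) (I : 'I_k -> {set 'I_m}) (r : R)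
    (E F : normedModType K) : set (('I_m -> E) -> F) :=
  [set T | @bounded_multilinear m E F T /\
     forall x : 'I_m -> nat -> E, (forall i, weakly_summable (x i)) ->
       (\esum_(j in Omega I)
          (real_norm (T (fun i => x i (j i))) `^ r)%:E < +oo)%E].

End spaces_of_operators.

(* The default value [m] of the iterated minimum is neutral here, since every
   block has at most [m] elements and the family of blocks is non-empty. *)
Definition min_block (m k : nat) (I : 'I_k -> {set 'I_m}) : nat :=
  \big[minn/m]_(l < k) #|I l|.

(* Main.v *)
Require Import Defs.
From HB Require Import structures.
From mathcomp Require Import all_boot all_order all_algebra.
From mathcomp Require Import finmap complex ring lra.
From mathcomp Require Import all_classical all_reals all_analysis.

Set Implicit Arguments.
Unset Strict Implicit.
Unset Printing Implicit Defensive.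

Import Order.TTheory GRing.Theory Num.Theory.
Import numFieldNormedType.Exports.

Local Open Scope ring_scope.

(** Why the theorem is true.

    Summability.  By Grothendieck's theorem, a weakly summable sequence in l1,
    seen as a matrix with entries x_j(t) bounded from l_infty to l1, factors
    through l2: there are weights lam and mu of finite total mass such that
    the matrix lam_j^(-1/2) x_j(t) mu_t^(-1/2) is a contraction of l2
    ([scalar_weights]).  A tensor product of contractions is a contraction, so
    a bounded m-linear T satisfies the weighted square estimate

      sum_j prod_i lam_(j_i)^-1 |T(x^1_(j_1), ..., x^m_(j_m))|^2 < oo

    over all of N^m ([weighted_multiple_sum]).  On Omega, the index j is
    constant on each block, hence prod_i lam_(j_i) is at most the n-th power of
    a product of one weight per block, and its n-th root is summable
    ([sum_diagonal_weights]).  Hoelder's inequality with 1/r = 1/2 + n/2 then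
    gives the exponent r = 2/(n+1); here Hoelder is replaced by the pointwise
    bound [powR_le_weighted].  Everything is proved for finite matrices with
    constants independent of their size, and truncation of the vectors of l1
    gives the infinite statement.

    Grothendieck's theorem itself is obtained in two steps.  The inequality
    comes from bounding the supremum of sum a_jk <x_j, y_k> over unit vectors in
    terms of itself: represent vectors by Rademacher sums, truncate the
    values, and bound the tails by the fourth moment
    ([vector_bound_step]).  The weights come from the second-order condition at
    a nearly maximal configuration of vectors, perturbed in a direction
    orthogonal to all of them ([perturbation_bound]), so that neither
    compactness nor a separation argument is used.

    Sharpness.  Take B a block of minimal size n, and let W_d be the Walsh
    matrix of order 2^d, with rows w_u.  The m-linear map with coordinates
    rho^d prod_(i in B) <w_u, v_i> prod_(i notin B) v_i(0), indexed by d and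
    u < 2^d, is bounded into l2 as soon as 2 rho^2 < 1, and the vectors rho^d 2^-d w_u form a weakly
    summable sequence for the same reason.  The value at the (d, u)-th vectors
    has norm at least rho^(d(n+1)), so with rho^((n+1)r) = 1/2 each of
    the infinitely many levels d contributes at least 1 to the sum of the r-th
    powers; the constraint 2 rho^2 < 1 is precisely r < 2/(n+1). *)

(** * Grothendieck's inequality *)

Lemma sum_ord_double (V : nmodType) (F : nat -> V) n :
  \sum_(w < n.*2) F w = \sum_(w < n) (F w.*2 + F w.*2.+1).
Proof.
elim: n => [|n IHn]; first by rewrite !big_ord0.
by rewrite doubleS !big_ord_recr /= IHn addrA.
Qed.

Section Grothendieck.
Variable R : realType.
Implicit Types (x y : nat -> R) (d : nat).

Definition dotp d x y : R := \sum_(i < d) x i * y i.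

(** The linear combination of d independent signs with coefficients x, at the
    outcome encoded by the binary digits of w < 2 ^ d.  Encoding outcomes by
    numbers makes the random variable a vector of length 2 ^ d, to which
    [dotp] applies again. *)
Fixpoint rademacher_sum x d (w : nat) : R :=
  if d is d'.+1 then rademacher_sum x d' w./2 + (-1) ^+ odd w * x d' else 0.

Lemma rademacher_sumE x d w :
  (rademacher_sum x d.+1 w.*2 = rademacher_sum x d w + x d) *
  (rademacher_sum x d.+1 w.*2.+1 = rademacher_sum x d w - x d).
Proof.
by split; rewrite /= ?uphalf_double ?doubleK odd_double/= ?expr0 ?expr1 ?mul1r ?mulN1r.
Qed.

(** Distinct signs are orthogonal, so x |-> [rademacher_sum] x is an isometry
    up to the factor 2 ^ d. *)
Lemma sum_rademacherM x y d :
  \sum_(w < 2 ^ d) rademacher_sum x d w * rademacher_sum y d w =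
  2 ^+ d * dotp d x y.
Proof.
rewrite /dotp; elim: d => [|d IHd].
  by rewrite big_ord_recr !big_ord0 /= mulr0 mulr0 addr0.
rewrite expnS mul2n.
rewrite (sum_ord_double (fun w => rademacher_sum x d.+1 w * rademacher_sum y d.+1 w)).
under eq_bigr => w _ do rewrite !rademacher_sumE.
rewrite (eq_bigr (fun w : 'I_(2 ^ d) =>
  2 * (rademacher_sum x d w * rademacher_sum y d w) + 2 * (x d * y d))); last first.
  by move=> w _; ring.
rewrite big_split /= -mulr_sumr IHd sumr_const card_ord big_ord_recr /= exprS.
by rewrite -[_ *+ (2 ^ d)]mulr_natl natrX; ring.
Qed.

(** The fourth moment of a Rademacher sum is at most three times the square of
    its second moment: expanding (X + c)^4 + (X - c)^4 cancels the odd powers. *)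
Lemma sum_rademacher4 x d :
  \sum_(w < 2 ^ d) rademacher_sum x d w ^+ 4 <= 2 ^+ d * (3 * dotp d x x ^+ 2).
Proof.
elim: d => [|d IHd].
  by rewrite big_ord_recr !big_ord0 /= /dotp big_ord0 !expr0n /= !mulr0 addr0.
rewrite expnS mul2n (sum_ord_double (fun w => rademacher_sum x d.+1 w ^+ 4)).
under eq_bigr => w _ do rewrite !rademacher_sumE.
rewrite (eq_bigr (fun w : 'I_(2 ^ d) => 2 * rademacher_sum x d w ^+ 4 +
  12 * x d ^+ 2 * (rademacher_sum x d w * rademacher_sum x d w) + 2 * x d ^+ 4)); last first.
  by move=> w _; ring.
rewrite !big_split /= -!mulr_sumr sum_rademacherM sumr_const card_ord.
rewrite -[_ *+ (2 ^ d)]mulr_natl natrX /dotp big_ord_recr /= -/(dotp d x x) (exprS 2 d).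
set q := dotp d x x in IHd *; set c := 2 ^+ d in IHd *.
have c0 : 0 <= c by rewrite exprn_ge0.
have : 0 <= c * x d ^+ 4 by rewrite mulr_ge0// exprn_even_ge0.
move: IHd; set S := \sum_(w < _) _ => IHd cx. lra.
Qed.

Definition clamp (a : R) : R := if a < - 2 then - 2 else if 2 < a then 2 else a.

Lemma clamp_bound a : `|clamp a| <= 2.
Proof. by rewrite /clamp ler_norml; case: ltP => h1; [|case: ltP => h2]; lra. Qed.

Lemma clamp_sqr a : clamp a ^+ 2 <= a ^+ 2.
Proof. by rewrite /clamp; case: ltP => h1; [|case: ltP => h2]; nra. Qed.

(** The excess over 2 is at most b^2 / 8, by (b - 4)^2 >= 0; this is what turns
    the fourth moment into a bound for the truncation error. *)
Lemma clamp_rest a : (a - clamp a) ^+ 2 <= a ^+ 4 / 64.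
Proof.
have H (b : R) : 2 <= b -> (b - 2) ^+ 2 <= b ^+ 4 / 64.
  move=> b2; have h : b - 2 <= b ^+ 2 / 8 by have := sqr_ge0 (b - 4); nra.
  have -> : b ^+ 4 / 64 = (b ^+ 2 / 8) ^+ 2 by field.
  by rewrite ler_sqr ?nnegrE; nra.
rewrite /clamp; case: ltP => h1; [|case: ltP => h2].
- have := H (- a); rewrite (_ : (- a) ^+ 4 = a ^+ 4); last by ring.
  by rewrite (_ : (- a - 2) ^+ 2 = (a - - 2) ^+ 2); [apply; lra|ring].
- by apply: H; lra.
- by rewrite subrr expr0n divr_ge0// exprn_even_ge0.
Qed.

Section inequality.
Variables (I J : finType) (a : I -> J -> R) (A : R).
Hypothesis aA : forall (s : I -> R) (t : J -> R),
  (forall j, `|s j| <= 1) -> (forall k, `|t k| <= 1) ->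
  \sum_j \sum_k a j k * (s j * t k) <= A.

(** The form attached to a, with scalars replaced by vectors of Euclidean
    spaces of arbitrary dimension. *)
Definition vector_bound (B : R) := forall d (x : I -> nat -> R) (y : J -> nat -> R),
  (forall j, dotp d (x j) (x j) <= 1) -> (forall k, dotp d (y k) (y k) <= 1) ->
  \sum_j \sum_k a j k * dotp d (x j) (y k) <= B.

Lemma dotp_le1 d x y : dotp d x x <= 1 -> dotp d y y <= 1 -> `|dotp d x y| <= 1.
Proof.
have H (u v : nat -> R) : 2 * dotp d u v <= dotp d u u + dotp d v v.
  rewrite /dotp mulr_sumr -big_split /= ler_sum// => i _.
  by have := sqr_ge0 (u i - v i); nra.
have N (u v : nat -> R) : dotp d (fun i => - u i) v = - dotp d u v.
  by rewrite /dotp -sumrN; apply: eq_bigr => i _; rewrite mulNr.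
have NN (u : nat -> R) : dotp d (fun i => - u i) (fun i => - u i) = dotp d u u.
  by rewrite /dotp; apply: eq_bigr => i _; rewrite mulrNN.
move=> xx yy; rewrite ler_norml.
have := H x y; have := H (fun i => - x i) y; rewrite N NN; lra.
Qed.

Lemma vector_bound_entries : vector_bound (\sum_j \sum_k `|a j k|).
Proof.
move=> d x y x1 y1; apply: ler_sum => j _; apply: ler_sum => k _.
apply: le_trans (ler_norm _) _; rewrite normrM -[leRHS]mulr1 ler_wpM2l//.
exact: dotp_le1.
Qed.

Lemma vector_boundZ B c d (x : I -> nat -> R) (y : J -> nat -> R) :
  vector_bound B -> 0 < c ->
  (forall j, dotp d (x j) (x j) <= c) -> (forall k, dotp d (y k) (y k) <= c) ->
  \sum_j \sum_k a j k * dotp d (x j) (y k) <= c * B.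
Proof.
move=> HB c0 xc yc; pose q := (Num.sqrt c)^-1.
have q2 : q * q = c^-1 by rewrite -invfM -expr2 sqr_sqrtr// ltW.
have dotq u v : dotp d (fun i => q * u i) (fun i => q * v i) = c^-1 * dotp d u v.
  by rewrite /dotp mulr_sumr; apply: eq_bigr => i _; rewrite -q2; ring.
have := HB d (fun j i => q * x j i) (fun k i => q * y k i).
under eq_bigr do under eq_bigr do rewrite dotq mulrCA.
under eq_bigr do rewrite -mulr_sumr.
rewrite -mulr_sumr ler_pdivrMl//; apply => j; rewrite dotq ler_pdivrMl// mulr1.
  exact: xc.
exact: yc.
Qed.

(** Replace x_j and y_k by Rademacher sums X_j and Y_k and write X Y =
    cX cY + cX (Y - cY) + (X - cX) Y with c the truncation at level 2.  The
    first term is a mean of scalar configurations of size 2, whence 4 A; in the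
    other two a truncation error of norm at most 1/4 is paired with a vector of
    norm at most 1, and the bound B, applied to random variables as vectors of
    length 2 ^ d, yields B / 4 twice. *)
Lemma vector_bound_step B : vector_bound B -> vector_bound (4 * A + B / 2).
Proof.
move=> HB d x y x1 y1; set N : R := 2 ^+ d.
have N0 : 0 < N by rewrite exprn_gt0.
pose X j w := rademacher_sum (x j) d w; pose Y k w := rademacher_sum (y k) d w.
pose D := (2 ^ d)%N.
have XX z : dotp d z z <= 1 -> dotp D (rademacher_sum z d) (rademacher_sum z d) <= N.
  by move=> z1; rewrite /dotp sum_rademacherM -[leRHS]mulr1 ler_wpM2l ?(ltW N0).
have cX z : dotp d z z <= 1 ->
    dotp D (clamp \o rademacher_sum z d) (clamp \o rademacher_sum z d) <= N.
  move=> /XX; apply: le_trans; apply: ler_sum => w _ /=.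
  by rewrite -!expr2 clamp_sqr.
pose rst (z : nat -> R) w := rademacher_sum z d w - clamp (rademacher_sum z d w).
have rX z : dotp d z z <= 1 -> dotp D (fun w => 4 * rst z w) (fun w => 4 * rst z w) <= N.
  move=> z1; rewrite /dotp.
  apply: (@le_trans _ _ (\sum_(w < D) (rademacher_sum z d w) ^+ 4 / 4)).
    apply: ler_sum => w _; rewrite /rst; have := clamp_rest (rademacher_sum z d w); lra.
  rewrite -mulr_suml; have := sum_rademacher4 z d; rewrite -/N -/D.
  have z0 : 0 <= dotp d z z by apply: sumr_ge0 => i _; rewrite -expr2 sqr_ge0.
  have : N * (3 * dotp d z z ^+ 2) <= N * 3.
    by rewrite ler_wpM2l ?(ltW N0)//; nra.
  by lra.
have part1 : \sum_j \sum_k a j k * dotp D (clamp \o X j) (clamp \o Y k) <= N * (4 * A).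
  rewrite /dotp.
  rewrite (eq_bigr (fun j => \sum_(w < D) \sum_k a j k * (clamp (X j w) * clamp (Y k w)))); last first.
    by move=> j _; rewrite exchange_big; apply: eq_bigr => k _; rewrite mulr_sumr.
  rewrite exchange_big /=.
  apply: (@le_trans _ _ (\sum_(w < D) 4 * A)).
    apply: ler_sum => w _.
    have := aA (s := fun j => clamp (X j w) / 2) (t := fun k => clamp (Y k w) / 2).
    have H z : `|clamp z / 2| <= 1 by have := clamp_bound z; rewrite !ler_norml; lra.
    move=> /(_ (fun j => H (X j w)) (fun k => H (Y k w))).
    rewrite (_ : \sum_j _ = (\sum_j \sum_k a j k * (clamp (X j w) * clamp (Y k w))) / 4); first lra.
    rewrite mulr_suml; apply: eq_bigr => j _; rewrite mulr_suml; apply: eq_bigr => k _.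
    by field.
  by rewrite sumr_const card_ord -[_ *+ D]mulr_natl natrX.
have part2 : \sum_j \sum_k a j k * dotp D (clamp \o X j) (fun w => 4 * rst (y k) w) <= N * B.
  by apply: vector_boundZ => // [j|k]; [exact: cX|exact: rX].
have part3 : \sum_j \sum_k a j k * dotp D (fun w => 4 * rst (x j) w) (Y k) <= N * B.
  by apply: vector_boundZ => // [j|k]; [exact: rX|exact: XX].
rewrite -(ler_pM2l N0).
have -> : N * (\sum_j \sum_k a j k * dotp d (x j) (y k)) =
  (\sum_j \sum_k a j k * dotp D (clamp \o X j) (clamp \o Y k)) +
  ((\sum_j \sum_k a j k * dotp D (clamp \o X j) (fun w => 4 * rst (y k) w)) / 4 +
  (\sum_j \sum_k a j k * dotp D (fun w => 4 * rst (x j) w) (Y k)) / 4).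
  rewrite mulr_sumr !mulr_suml -!big_split /=; apply: eq_bigr => j _.
  rewrite mulr_sumr !mulr_suml -!big_split /=; apply: eq_bigr => k _.
  rewrite mulrCA -sum_rademacherM /dotp !mulr_sumr !mulr_suml -!big_split /=.
  by apply: eq_bigr => w _; rewrite /rst /X /Y; field.
lra.
Qed.

(** Iterating B |-> 4 A + B / 2 from the trivial bound converges to 8 A. *)
Lemma Grothendieck_inequality : vector_bound (8 * A).
Proof.
pose S := \sum_j \sum_k `|a j k|.
have S0 : 0 <= S by apply: sumr_ge0 => j _; apply: sumr_ge0.
have A0 : 0 <= A.
  have := aA (s := fun=> 0) (t := fun=> 0).
  rewrite !big1; last by move=> j _; rewrite big1// => k _; rewrite mul0r mulr0.
  by apply => ?; rewrite normr0.
have H n : vector_bound (8 * A + S / 2 ^+ n).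
  elim: n => [|n /vector_bound_step IHn].
    move=> d x y x1 y1; apply: le_trans (vector_bound_entries x1 y1) _.
    by rewrite expr0 divr1 lerDr mulr_ge0.
  move=> d x y x1 y1; apply: le_trans (IHn d x y x1 y1) _.
  by rewrite exprS invfM; lra.
move=> d x y x1 y1; apply/ler_addgt0Pr => e e0.
have [n hn] : exists n : nat, S / e <= n%:R.
  by exists (Num.bound (S / e)); rewrite ltW// archi_boundP// divr_ge0// ltW.
apply: le_trans (H n d x y x1 y1) _; rewrite lerD2l ler_pdivrMr ?exprn_gt0//.
rewrite ler_pdivrMr// in hn; rewrite mulrC; apply: le_trans hn _.
by rewrite ler_wpM2r ?(ltW e0)// -natrX ler_nat ltnW// ltn_expl.
Qed.

(** * Weights from an almost extremal configuration *)

Definition vector_values : set R := [set v | exists d (x : I -> nat -> R) (y : J -> nat -> R),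
  [/\ forall j, dotp d (x j) (x j) <= 1, forall k, dotp d (y k) (y k) <= 1 &
     v = \sum_j \sum_k a j k * dotp d (x j) (y k)]]%classic.

Lemma has_sup_vector_values : has_sup vector_values.
Proof.
split; last first.
  by exists (8 * A) => _ [d [x [y [x1 y1 ->]]]]; exact: Grothendieck_inequality.
exists (\sum_j \sum_k a j k * dotp 0 (fun=> 0) (fun=> 0)), 0%N, (fun _ _ => 0), (fun _ _ => 0).
by split => // ?; rewrite /dotp big_ord0.
Qed.

Lemma vector_bound_sup : vector_bound (sup vector_values).
Proof.
move=> d x y x1 y1; apply: sup_upper_bound; first exact: has_sup_vector_values.
by exists d, x, y.
Qed.

Lemma sup_vector_values_ge0 : 0 <= sup vector_values.
Proof.
apply: sup_upper_bound; first exact: has_sup_vector_values.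
exists 0%N, (fun _ _ => 0), (fun _ _ => 0); split => [?|?|]; rewrite /dotp ?big_ord0//.
by rewrite big1// => j _; rewrite big1// => k _; rewrite mulr0.
Qed.

(** Tilting x_j and y_k towards a common new orthogonal direction by angles of
    size e f_j and e g_k changes the form by e^2 times the difference of the
    two sides below, up to O(e^4).  At a configuration within e^4 of the
    supremum, this change cannot exceed O(e^4). *)
Lemma perturbation_bound e d (x : I -> nat -> R) (y : J -> nat -> R) f g :
  let B := sup vector_values in
  0 < e -> e <= 1 ->
  (forall j, dotp d (x j) (x j) <= 1) -> (forall k, dotp d (y k) (y k) <= 1) ->
  B - e ^+ 4 < \sum_j \sum_k a j k * dotp d (x j) (y k) ->
  (forall j, `|f j| <= 1) -> (forall k, `|g k| <= 1) ->
  \sum_j \sum_k a j k * (f j * g k) <=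
  (\sum_j \sum_k a j k * dotp d (x j) (y k) * (f j ^+ 2 + g k ^+ 2)) / 2 +
  e ^+ 2 * (1 + B + \sum_j \sum_k `|a j k|).
Proof.
move=> B e0 e1 x1 y1 hv f1 g1.
have B0 : 0 <= B := sup_vector_values_ge0.
have sqr_le1 (b : R) : `|b| <= 1 -> b ^+ 2 <= 1.
  by rewrite ler_norml; have := sqr_ge0 b; nra.
(* The d-th coordinate is the new direction; 1 - (e b)^2 / 2 approximates
   the cosine, so that the squared norm exceeds 1 by O(e^4) only. *)
pose p b (z : nat -> R) i := if (i < d)%N then (1 - e ^+ 2 * b ^+ 2 / 2) * z i else e * b.
have pE b c z z' : dotp d.+1 (p b z) (p c z') =
    (1 - e ^+ 2 * b ^+ 2 / 2) * (1 - e ^+ 2 * c ^+ 2 / 2) * dotp d z z' + e ^+ 2 * (b * c).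
  rewrite /dotp big_ord_recr /= /p ltnn; congr (_ + _); last by ring.
  by rewrite mulr_sumr; apply: eq_bigr => i _; rewrite ltn_ord; ring.
have p1 b z : `|b| <= 1 -> dotp d z z <= 1 -> dotp d.+1 (p b z) (p b z) <= 1 + e ^+ 4.
  move=> /sqr_le1 b1 z1; rewrite pE.
  set t := e ^+ 2 * b ^+ 2.
  have : (1 - t / 2) * (1 - t / 2) * dotp d z z <= (1 - t / 2) ^+ 2.
    by rewrite -expr2 -[leRHS]mulr1 ler_wpM2l// sqr_ge0.
  have -> : (1 - t / 2) ^+ 2 = 1 - t + t ^+ 2 / 4 by field.
  have : t ^+ 2 <= e ^+ 4.
    have -> : t ^+ 2 = e ^+ 4 * (b ^+ 2) ^+ 2 by rewrite /t; ring.
    by rewrite -[leRHS]mulr1 ler_wpM2l ?exprn_ge0 ?(ltW e0)//; have := sqr_ge0 b; nra.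
  by have := sqr_ge0 t; lra.
have := @vector_boundZ B (1 + e ^+ 4) d.+1 (fun j => p (f j) (x j)) (fun k => p (g k) (y k))
  vector_bound_sup.
have c0 : 0 < 1 + e ^+ 4 by rewrite addr_gt0// exprn_gt0.
move=> /(_ c0 (fun j => p1 _ _ (f1 j) (x1 j)) (fun k => p1 _ _ (g1 k) (y1 k))).
set Z := \sum_j \sum_k a j k * (f j * g k).
set L := \sum_j \sum_k a j k * dotp d (x j) (y k) * _.
set v := \sum_j \sum_k a j k * dotp d (x j) (y k) in hv *.
set S := \sum_j \sum_k `|a j k|.
pose Q := \sum_j \sum_k a j k * dotp d (x j) (y k) * (f j ^+ 2 * g k ^+ 2).
have -> : \sum_j \sum_k a j k * dotp d.+1 (p (f j) (x j)) (p (g k) (y k)) =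
    v + (e ^+ 2 * Z - e ^+ 2 / 2 * L + e ^+ 4 / 4 * Q).
  rewrite /v /Z /L /Q !mulr_sumr -sumrN -!big_split /=; apply: eq_bigr => j _.
  rewrite !mulr_sumr -sumrN -!big_split /=; apply: eq_bigr => k _.
  by rewrite pE; field.
have QS : - S <= Q.
  rewrite /Q /S -sumrN; apply: ler_sum => j _; rewrite -sumrN; apply: ler_sum => k _.
  suff : `|a j k * dotp d (x j) (y k) * (f j ^+ 2 * g k ^+ 2)| <= `|a j k|.
    by rewrite ler_norml => /andP[].
  rewrite normrM (normrM (a j k)) (normrM (f j ^+ 2)) -mulrA -[leRHS]mulr1 ler_wpM2l//.
  have sqr_norm_le1 (b : R) : `|b| <= 1 -> `|b ^+ 2| <= 1.
    by move=> b1; rewrite ger0_norm ?sqr_ge0//; exact: sqr_le1.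
  have dot1 := dotp_le1 (x1 j) (y1 k).
  have fg1 : `|f j ^+ 2| * `|g k ^+ 2| <= 1 by apply: mulr_ile1; rewrite ?sqr_norm_le1.
  by apply: mulr_ile1; rewrite ?mulr_ge0 ?normr_ge0.
have S0 : 0 <= S by apply: sumr_ge0 => j _; apply: sumr_ge0.
have e20 : 0 < e ^+ 2 by rewrite exprn_gt0.
move=> H; rewrite -(ler_pM2l e20).
have e4 : e ^+ 4 = e ^+ 2 * e ^+ 2 by ring.
set E := e ^+ 2 in H hv e4 e20 *; rewrite e4 in H hv.
have h1 : E * E * (- S) <= E * E * Q by rewrite ler_wpM2l// mulr_ge0// ltW.
have h2 : 0 <= E * E * S by rewrite !mulr_ge0// ltW.
by nra.
Qed.

(** The weights are the marginals of the matrix a_jk <x_j, y_k> at a nearly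
    maximal configuration, which sum to at most 8 A; the slack c absorbs the
    error term of [perturbation_bound]. *)
Lemma Grothendieck_weights c : 0 < c -> exists (lam : I -> R) (mu : J -> R),
  [/\ \sum_j lam j <= 8 * A + c * #|I|%:R, \sum_k mu k <= 8 * A + c * #|J|%:R &
  forall f g, 2 * \sum_j \sum_k a j k * (f j * g k) <=
    \sum_j lam j * f j ^+ 2 + \sum_k mu k * g k ^+ 2].
Proof.
move=> c0; set B := sup vector_values; have B0 : 0 <= B := sup_vector_values_ge0.
set S := \sum_j \sum_k `|a j k|.
have S0 : 0 <= S by apply: sumr_ge0 => j _; apply: sumr_ge0.
pose W := 1 + B + S; have W0 : 0 < W by rewrite /W; lra.
(* This choice gives e <= 1 and e^2 W <= c / 2, where e^2 W is the error term of
   [perturbation_bound]. *)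
pose e := c / (2 * W + c); have d0 : 0 < 2 * W + c by lra.
have e0 : 0 < e by rewrite divr_gt0.
have e1 : e <= 1 by rewrite ler_pdivrMr// mul1r; lra.
have eW : e ^+ 2 * W <= c / 2.
  apply: (@le_trans _ _ (e * W)).
    by rewrite ler_wpM2r ?(ltW W0)// expr2 -[leRHS]mulr1 ler_wpM2l ?(ltW e0).
  by rewrite /e mulrAC ler_pdivrMr//; nra.
have [_ [d [x [y [x1 y1 ->]]]] hv] :=
  sup_adherent (exprn_gt0 4 e0) has_sup_vector_values.
set v := \sum_j \sum_k _ in hv.
have v8 : v <= 8 * A by exact: Grothendieck_inequality.
exists (fun j => \sum_k a j k * dotp d (x j) (y k) + c),
  (fun k => \sum_j a j k * dotp d (x j) (y k) + c); split.
- by rewrite big_split /= sumr_const -[c *+ _]mulr_natr lerD2r.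
- by rewrite big_split /= sumr_const -[c *+ _]mulr_natr lerD2r exchange_big.
move=> f g.
(* Both sides are quadratic in (f, g), so it is enough to treat the case
   q = 1, where all entries are at most 1; if q = 0, both sides vanish. *)
pose q := \sum_j f j ^+ 2 + \sum_k g k ^+ 2.
have fq j : f j ^+ 2 <= q.
  rewrite /q (bigD1 j)//= -addrA lerDl addr_ge0 ?sumr_ge0// => *; exact: sqr_ge0.
have gq k : g k ^+ 2 <= q.
  rewrite /q (bigD1 k)//= addrCA lerDl addr_ge0 ?sumr_ge0// => *; exact: sqr_ge0.
have q0 : 0 <= q by rewrite addr_ge0 ?sumr_ge0// => *; exact: sqr_ge0.
have -> : \sum_j (\sum_k a j k * dotp d (x j) (y k) + c) * f j ^+ 2 +
    \sum_k (\sum_j a j k * dotp d (x j) (y k) + c) * g k ^+ 2 =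
    \sum_j \sum_k a j k * dotp d (x j) (y k) * (f j ^+ 2 + g k ^+ 2) + c * q.
  rewrite /q mulrDr !mulr_sumr.
  under [X in X + _ = _]eq_bigr do rewrite mulrDl.
  under [X in _ + X = _]eq_bigr do rewrite mulrDl.
  rewrite !big_split /= addrACA; congr (_ + _).
  under [X in _ + X = _]eq_bigr do rewrite mulr_suml.
  rewrite exchange_big -big_split /=; apply: eq_bigr => j _.
  rewrite mulr_suml -big_split /=; apply: eq_bigr => k _; ring.
have [q_eq0|qn0] := eqVneq q 0; last first.
  have qp : 0 < q by rewrite lt_neqAle eq_sym qn0.
  pose r := Num.sqrt q; have r0 : 0 < r by rewrite sqrtr_gt0.
  have r2 : r ^+ 2 = q by rewrite sqr_sqrtr.
  have H b : b ^+ 2 <= q -> `|b / r| <= 1.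
    move=> bq; rewrite normrM normfV (gtr0_norm r0) ler_pdivrMr// mul1r.
    by rewrite -(ler_pXn2r (n := 2)) ?nnegrE// ?(ltW r0)// real_normK ?num_real// r2.
  have := perturbation_bound e0 e1 x1 y1 hv (fun j => H _ (fq j)) (fun k => H _ (gq k)).
  rewrite -/S -/W.
  have -> : \sum_j \sum_k a j k * (f j / r * (g k / r)) =
      (\sum_j \sum_k a j k * (f j * g k)) / q.
    rewrite mulr_suml; apply: eq_bigr => j _; rewrite mulr_suml; apply: eq_bigr => k _.
    by rewrite -r2; field; rewrite gt_eqF.
  have -> : \sum_j \sum_k a j k * dotp d (x j) (y k) * ((f j / r) ^+ 2 + (g k / r) ^+ 2) =
      (\sum_j \sum_k a j k * dotp d (x j) (y k) * (f j ^+ 2 + g k ^+ 2)) / q.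
    rewrite mulr_suml; apply: eq_bigr => j _; rewrite mulr_suml; apply: eq_bigr => k _.
    by rewrite -r2; field; rewrite gt_eqF.
  rewrite ler_pdivrMr// mulrDl; set Z := \sum_j _; set L := \sum_j _ => HZ.
  have := ler_wpM2r q0 eW.
  have -> : L = L / q / 2 * q * 2 by field.
  lra.
rewrite q_eq0 mulr0 addr0.
have f0 j : f j = 0.
  by apply/eqP; rewrite -sqrf_eq0; apply/eqP/le_anti; rewrite sqr_ge0 andbT -q_eq0 fq.
have g0 k : g k = 0.
  by apply/eqP; rewrite -sqrf_eq0; apply/eqP/le_anti; rewrite sqr_ge0 andbT -q_eq0 gq.
by rewrite !big1 ?mulr0// => j _; rewrite big1// => k _; rewrite ?f0 ?g0 ?expr0n ?addr0 ?mulr0.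
Qed.

End inequality.
End Grothendieck.

(** * Common weights for families of real or complex matrices *)

(** Only the fact that this depends neither on the number of rows nor on the
    number of columns of the matrices matters. *)
Definition weight_bound (R : realType) (n : nat) (A : R) : R :=
  (1 + n%:R * (8 * A + 1)) ^+ 2.

(** Averaging the weights of the members of the family, and moving the total
    mass of the row weights into the column weights, makes the weights common and
    the row weights a subprobability.  The quadratic inequality of
    [Grothendieck_weights] becomes a weighted contraction by choosing f to be
    the image of the given vector, divided by lam. *)
Lemma family_weights (R : realType) (G I J : finType) (a : G -> I -> J -> R) (A : R) :
  0 <= A ->
  (forall g (s : I -> R) (t : J -> R),
    (forall j, `|s j| <= 1) -> (forall k, `|t k| <= 1) ->
    \sum_j \sum_k a g j k * (s j * t k) <= A) ->
  exists (lam : I -> R) (mu : J -> R),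
  [/\ forall j, 0 < lam j, \sum_j lam j <= 1, forall k, 0 <= mu k,
      \sum_k mu k <= weight_bound #|G| A &
  forall g f, \sum_j (lam j)^-1 * (\sum_k a g j k * f k) ^+ 2 <=
    \sum_k mu k * f k ^+ 2].
Proof.
(* The slack c is small enough to add at most 1 to the mass of each family of
   weights, whatever the size of the matrices. *)
move=> A0 aA; pose c : R := (1 + #|I|%:R + #|J|%:R)^-1.
have i0 : 0 <= #|I|%:R :> R by []. have j0 : 0 <= #|J|%:R :> R by [].
have c0 : 0 < c by rewrite invr_gt0; lra.
have cI : c * #|I|%:R <= 1 by rewrite ler_pdivrMl; lra.
have cJ : c * #|J|%:R <= 1 by rewrite ler_pdivrMl; lra.
have /choice[L HL] : forall g, exists p : (I -> R) * (J -> R),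
  [/\ \sum_j p.1 j <= 8 * A + 1, \sum_k p.2 k <= 8 * A + 1 &
  forall f h, 2 * \sum_j \sum_k a g j k * (f j * h k) <=
    \sum_j p.1 j * f j ^+ 2 + \sum_k p.2 k * h k ^+ 2].
  move=> g; have [lam [mu [h1 h2 h3]]] := Grothendieck_weights (aA g) c0.
  by exists (lam, mu); split => //=; [apply: le_trans h1 _|apply: le_trans h2 _]; lra.
have zz g : \sum_j \sum_k a g j k * (0 * 0 : R) = 0.
  by rewrite big1// => j _; rewrite big1// => k _; rewrite mulr0 mulr0.
have L1 g j : 0 <= (L g).1 j.
  have [_ _] := HL g; move=> /(_ (fun i => (i == j)%:R) (fun=> 0)).
  rewrite big1; last by move=> i _; rewrite big1// => k _; rewrite !mulr0.
  rewrite mulr0 [X in _ + X]big1; last by move=> k _; rewrite expr0n mulr0.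
  rewrite (bigD1 j)//= eqxx expr1n mulr1 big1 ?addr0// => i /negPf ->.
  by rewrite expr0n mulr0.
have L2 g k : 0 <= (L g).2 k.
  have [_ _] := HL g; move=> /(_ (fun=> 0) (fun i => (i == k)%:R)).
  rewrite big1; last by move=> i _; rewrite big1// => ? _; rewrite mul0r mulr0.
  rewrite mulr0 [X in X + _]big1; last by move=> j _; rewrite expr0n mulr0.
  rewrite (bigD1 k)//= eqxx expr1n mulr1 big1 ?addr0 ?add0r// => i /negPf ->.
  by rewrite expr0n mulr0.
pose W : R := 1 + #|G|%:R * (8 * A + 1).
have GA : 0 <= #|G|%:R * (8 * A + 1) by rewrite mulr_ge0//; lra.
have W1 : 1 <= W by rewrite /W; lra.
have W0 : 0 < W by lra.
pose lam j := (\sum_g (L g).1 j + c) / W.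
have lam0 j : 0 < lam j by rewrite divr_gt0// ltr_wpDl// sumr_ge0.
exists lam, (fun k => W * \sum_g (L g).2 k); split => //.
- rewrite -mulr_suml ler_pdivrMr// mul1r big_split /= exchange_big /=.
  rewrite sumr_const -[c *+ _]mulr_natr /W addrC lerD//.
  apply: (@le_trans _ _ (\sum_(g : G) (8 * A + 1))).
    by apply: ler_sum => g _; have [] := HL g.
  by rewrite sumr_const -[(8 * A + 1) *+ _]mulr_natl.
- by move=> k; rewrite mulr_ge0 ?(ltW W0) ?sumr_ge0.
- rewrite -mulr_sumr exchange_big /= /weight_bound -/W expr2 ler_wpM2l ?(ltW W0)//.
  apply: (@le_trans _ _ (\sum_(g : G) (8 * A + 1))).
    by apply: ler_sum => g _; have [] := HL g.
  by rewrite sumr_const -[(8 * A + 1) *+ _]mulr_natl /W lerDr.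
move=> g f; pose w j := \sum_k a g j k * f k.
have [_ _ /(_ (fun j => w j / (W * lam j)) f)] := HL g.
have -> : \sum_j \sum_k a g j k * (w j / (W * lam j) * f k) =
    W^-1 * \sum_j (lam j)^-1 * w j ^+ 2.
  rewrite mulr_sumr; apply: eq_bigr => j _.
  rewrite (eq_bigr (fun k => w j / (W * lam j) * (a g j k * f k))); last first.
    by move=> k _; rewrite mulrCA.
  by rewrite -mulr_sumr -/(w j) invfM; ring.
have : \sum_j (L g).1 j * (w j / (W * lam j)) ^+ 2 <= W^-1 * \sum_j (lam j)^-1 * w j ^+ 2.
  rewrite mulr_sumr; apply: ler_sum => j _.
  have -> : W^-1 * ((lam j)^-1 * w j ^+ 2) = W * lam j * (w j / (W * lam j)) ^+ 2.
    by field; rewrite !gt_eqF.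
  rewrite ler_wpM2r ?sqr_ge0// /lam mulrCA mulfV ?gt_eqF// mulr1.
  rewrite (bigD1 g)//= -addrA lerDl addr_ge0 ?(ltW c0)// sumr_ge0//.
have : W * (\sum_k (L g).2 k * f k ^+ 2) <= \sum_k W * (\sum_g0 (L g0).2 k) * f k ^+ 2.
  rewrite mulr_sumr; apply: ler_sum => k _; rewrite -mulrA ler_wpM2l ?(ltW W0)//.
  by rewrite ler_wpM2r ?sqr_ge0// (bigD1 g)//= lerDl sumr_ge0.
set X := \sum_j _ * w j ^+ 2; rewrite -/X => h1 h2 h3.
have : W^-1 * X <= \sum_k (L g).2 k * f k ^+ 2 by lra.
by rewrite ler_pdivrMl// => h4; apply: le_trans h4 h1.
Qed.

Section scalar_parts.
Context {R : realType} {s : scalar_kind}.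
Local Notation K := (Defs.scalar R s).

Definition im_part : K -> R :=
  match s return Defs.scalar R s -> R with
  | RealScalars => fun=> 0
  | ComplexScalars => fun a => complex.Im a
  end.

Lemma real_norm_sqr (z : K) : real_norm z ^+ 2 = real_part z ^+ 2 + im_part z ^+ 2.
Proof.
rewrite /real_norm /im_part; case: s z => /= z.
  by rewrite real_normK ?num_real// expr0n addr0.
case: z => x y; rewrite /= sqr_sqrtr// ?addr_ge0 ?sqr_ge0//.
Qed.

Lemma real_partD (y z : K) : real_part (y + z) = real_part y + real_part z.
Proof. by case: s y z => //= -[? ?] [? ?]. Qed.

Lemma im_partD (y z : K) : im_part (y + z) = im_part y + im_part z.
Proof. by rewrite /im_part; case: s y z => /= [*|[? ?] [? ?]//]; rewrite addr0. Qed.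

Lemma real_partM (y z : K) :
  real_part (y * z) = real_part y * real_part z - im_part y * im_part z.
Proof.
by rewrite /im_part; case: s y z => /= [*|[? ?] [? ?]//]; rewrite mulr0 subr0.
Qed.

Lemma im_partM (y z : K) :
  im_part (y * z) = real_part y * im_part z + im_part y * real_part z.
Proof.
rewrite /im_part; case: s y z => /= [*|[? ?] [? ?]//=]; first by rewrite !(mulr0, mul0r) addr0.
Qed.

Lemma real_part_sum (I : finType) (F : I -> K) :
  real_part (\sum_i F i) = \sum_i real_part (F i).
Proof. by apply: big_morph => //; [exact: real_partD|case: s]. Qed.

Lemma im_part_sum (I : finType) (F : I -> K) :
  im_part (\sum_i F i) = \sum_i im_part (F i).
Proof. by apply: big_morph => //; [exact: im_partD|rewrite /im_part; case: s]. Qed.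

Lemma im_part_of_real (b : R) : im_part (of_real s b) = 0.
Proof. by rewrite /im_part; case: s. Qed.

Lemma real_part_le (z : K) : `|real_part z| <= real_norm z.
Proof.
rewrite -(ler_pXn2r (n := 2)) ?nnegrE ?real_norm_ge0//.
by rewrite real_normK ?num_real// real_norm_sqr lerDl sqr_ge0.
Qed.

Lemma im_part_le (z : K) : `|im_part z| <= real_norm z.
Proof.
rewrite -(ler_pXn2r (n := 2)) ?nnegrE ?real_norm_ge0//.
by rewrite real_normK ?num_real// real_norm_sqr lerDr sqr_ge0.
Qed.

(** Real and imaginary parts of the matrices form a real family of twice the
    size, so its common weights control complex combinations as well. *)
Lemma scalar_weights (G I J : finType) (a : G -> I -> J -> K) (A : R) :
  0 <= A ->
  (forall g (t : J -> R), (forall k, `|t k| <= 1) ->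
    \sum_j real_norm (\sum_k of_real s (t k) * a g j k) <= A) ->
  exists (lam : I -> R) (mu : J -> R),
  [/\ forall j, 0 < lam j, \sum_j lam j <= 1, forall k, 0 <= mu k,
      \sum_k mu k <= 4 * weight_bound (#|G| * 2) A &
  forall g (f : J -> K), \sum_j (lam j)^-1 * real_norm (\sum_k a g j k * f k) ^+ 2 <=
    \sum_k mu k * real_norm (f k) ^+ 2].
Proof.
move=> A0 aA.
pose b (p : G * bool) j k := if p.2 then real_part (a p.1 j k) else im_part (a p.1 j k).
have bA p (u : I -> R) (t : J -> R) : (forall j, `|u j| <= 1) -> (forall k, `|t k| <= 1) ->
    \sum_j \sum_k b p j k * (u j * t k) <= A.
  move=> u1 t1; apply: le_trans (aA p.1 t t1); apply: ler_sum => j _.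
  have -> : \sum_k b p j k * (u j * t k) = u j * (\sum_k t k * b p j k).
    by rewrite mulr_sumr; apply: eq_bigr => k _; ring.
  apply: le_trans (ler_norm _) _; rewrite normrM -[leRHS]mul1r ler_pM//.
  rewrite /b; case: p.2.
    apply: le_trans (real_part_le _); rewrite real_part_sum.
    under [X in _ <= `|X|]eq_bigr do
      rewrite real_partM of_realK im_part_of_real mul0r subr0.
    by [].
  apply: le_trans (im_part_le _); rewrite im_part_sum.
  under [X in _ <= `|X|]eq_bigr do
    rewrite im_partM of_realK im_part_of_real mul0r addr0.
  by [].
have [lam [mu [lam0 lam1 mu0 muM H]]] := family_weights A0 bA.
exists lam, (fun k => 4 * mu k); split => //.
- by move=> k; rewrite mulr_ge0.
- by rewrite -mulr_sumr ler_wpM2l// -[2%N]card_bool -card_prod.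
move=> g f.
pose x j := \sum_k real_part (a g j k) * real_part (f k).
pose y j := \sum_k im_part (a g j k) * im_part (f k).
pose z j := \sum_k real_part (a g j k) * im_part (f k).
pose w j := \sum_k im_part (a g j k) * real_part (f k).
have := H (g, true) (fun k => real_part (f k)); rewrite -/(x _) => hx.
have := H (g, false) (fun k => im_part (f k)); rewrite -/(y _) => hy.
have := H (g, true) (fun k => im_part (f k)); rewrite -/(z _) => hz.
have := H (g, false) (fun k => real_part (f k)); rewrite -/(w _) => hw.
have e j : real_norm (\sum_k a g j k * f k) ^+ 2 = (x j - y j) ^+ 2 + (z j + w j) ^+ 2.
  rewrite real_norm_sqr real_part_sum im_part_sum.
  under [X in X ^+ 2 + _ = _]eq_bigr do rewrite real_partM.
  under [X in _ + X ^+ 2 = _]eq_bigr do rewrite im_partM.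
  by rewrite !big_split /= sumrN.
have lam'0 j : 0 <= (lam j)^-1 by rewrite invr_ge0 ltW.
apply: (@le_trans _ _ (2 * ((\sum_j (lam j)^-1 * x j ^+ 2 + \sum_j (lam j)^-1 * y j ^+ 2) +
   (\sum_j (lam j)^-1 * z j ^+ 2 + \sum_j (lam j)^-1 * w j ^+ 2)))).
  rewrite -!big_split /= mulr_sumr; apply: ler_sum => j _.
  rewrite e -!mulrDr mulrCA ler_wpM2l//.
  by have := sqr_ge0 (x j + y j); have := sqr_ge0 (z j - w j); nra.
have -> : \sum_k 4 * mu k * real_norm (f k) ^+ 2 =
    4 * (\sum_k mu k * real_part (f k) ^+ 2 + \sum_k mu k * im_part (f k) ^+ 2).
  rewrite -big_split /= mulr_sumr; apply: eq_bigr => k _; rewrite real_norm_sqr; ring.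
move: hx hy hz hw; rewrite /x /y /z /w /b /=; lra.
Qed.

End scalar_parts.

(** * Vectors of l1 and l2 *)

Section sequence_spaces.
Context {R : realType} {s : scalar_kind}.
Local Notation K := (Defs.scalar R s).

Section coordinates.
Context (p : R) (p1 : 1 <= p).
Implicit Types (v w : lp s p1).

Lemma lp_funB v w t : (v - w : lp s p1) t = v t - w t.
Proof. by []. Qed.

Lemma lp_funZ (c : K) v t : (c *: v : lp s p1) t = c * v t.
Proof. by []. Qed.

Lemma lp_fun_sum (J : finType) (F : J -> lp s p1) t :
  (\sum_k F k : lp s p1) t = \sum_k F k t.
Proof. by apply: (big_morph (fun v : lp s p1 => v t)). Qed.

Lemma finite_support_lp (f : nat -> K) (P : nat) :
  (forall t, (P <= t)%N -> f t = 0) -> f \in lp_seq p1.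
Proof.
move=> f0; have p0 : p != 0 by rewrite gt_eqF// (lt_le_trans _ p1).
apply/asboolP; rewrite unlock (nneseries_split 0 P); last first.
  by move=> k _; rewrite lee_fin powR_ge0.
rewrite [X in (_ + X)%E]eseries0 ?adde0; last first.
  by move=> i; rewrite add0n => Pi _; rewrite f0// real_norm0 powR0.
by rewrite add0n sumEFin ltry.
Qed.

End coordinates.

Definition l1_of (f : nat -> K) (P : nat) (f0 : forall t, (P <= t)%N -> f t = 0) :
  l1 R s := Lp (finite_support_lp (lexx (1 : R)) f0).

Lemma unit_vector_support t0 t : (t0.+1 <= t)%N -> (t == t0)%:R = 0 :> K.
Proof. by rewrite ltn_neqAle eq_sym => /andP[/negPf ->]. Qed.

Definition unit_vector (t : nat) : l1 R s := l1_of (@unit_vector_support t).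

Lemma unit_vectorE t t' : (unit_vector t : lp s (lexx (1 : R))) t' = (t' == t)%:R.
Proof. by []. Qed.

Lemma l1_normE (v : l1 R s) :
  ((real_norm v)%:E = \sum_(0 <= t <oo) (real_norm ((v : lp s (lexx (1 : R))) t))%:E)%E.
Proof.
rewrite [real_norm v]real_norm_lp lp_normE invr1 poweRe1 ?lp_sum_ge0// unlock.
by apply: eq_eseriesr => t _; rewrite powRr1 ?real_norm_ge0.
Qed.

Lemma l2_normE (v : l2 R s) :
  ((real_norm v ^+ 2)%:E = \sum_(0 <= t <oo) (real_norm ((v : lp s (ler1n R 2)) t) ^+ 2)%:E)%E.
Proof.
transitivity (lp_sum 2 (v : lp s (ler1n R 2))).
  rewrite -powR_mulrn ?real_norm_ge0// -poweR_EFin [real_norm v]real_norm_lp lp_normE.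
  by rewrite -poweRrM mulVf// poweRe1 ?lp_sum_ge0.
by rewrite unlock; apply: eq_eseriesr => t _; rewrite powR_mulrn ?real_norm_ge0.
Qed.

Lemma real_norm1 : real_norm (1 : K) = 1.
Proof. by rewrite /real_norm normr1; case: s. Qed.

Lemma real_norm_unit_vector t : real_norm (unit_vector t) = 1.
Proof.
apply: EFin_inj; rewrite l1_normE (nneseries_split 0 t.+1); last first.
  by move=> k _; rewrite lee_fin real_norm_ge0.
rewrite [X in (_ + X)%E]eseries0 ?adde0; last first.
  by move=> i; rewrite add0n => Pi _; rewrite unit_vectorE unit_vector_support// real_norm0.
rewrite add0n big_nat_recr//= eqxx real_norm1 big1_seq ?add0e// => i.
rewrite mem_index_iota => /andP[_ /andP[_ it]].
by rewrite /= (ltn_eqF it) real_norm0.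
Qed.

Definition truncate P (v : l1 R s) : l1 R s :=
  \sum_(t < P) (v : lp s (lexx (1 : R))) t *: unit_vector t.

Lemma truncateE P (v : l1 R s) t : (truncate P v : lp s (lexx (1 : R))) t =
  if (t < P)%N then (v : lp s (lexx (1 : R))) t else 0.
Proof.
rewrite /truncate lp_fun_sum.
under eq_bigr => k _ do rewrite lp_funZ unit_vectorE.
case: ltnP => tP.
  rewrite (bigD1 (Ordinal tP))//= eqxx mulr1 big1 ?addr0// => k /negPf kt.
  by rewrite eq_sym (_ : (k == t :> nat) = false) ?mulr0.
by rewrite big1// => k _; rewrite gtn_eqF ?mulr0// (leq_trans (ltn_ord k)).
Qed.

Lemma real_norm_truncate P v : real_norm (truncate P v) <= real_norm v.
Proof.
rewrite -lee_fin !l1_normE; apply: lee_nneseries => [t _ _|t _].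
  by rewrite lee_fin real_norm_ge0.
by rewrite truncateE; case: ifP; rewrite // real_norm0 lee_fin real_norm_ge0.
Qed.

(** The norm of the remainder is the tail of a convergent series. *)
Lemma truncate_cvg v (e : R) : 0 < e ->
  \forall P \near \oo%classic, real_norm (v - truncate P v) <= e.
Proof.
move=> e0; pose f t : \bar R := (real_norm ((v : lp s (lexx (1 : R))) t))%:E.
have f0 t : (0 <= f t)%E by rewrite lee_fin real_norm_ge0.
have /fine_cvgP[_ /cvgrPdist_le /(_ _ e0)] :
    ((\sum_(N <= k <oo) f k)%E @[N --> \oo] --> 0%E)%classic.
  by apply: nneseries_tail_cvg => //; rewrite -l1_normE ltry.
apply: filterS => P; rewrite sub0r normrN => h.
have -> : real_norm (v - truncate P v) = fine (\sum_(P <= k <oo) f k)%E.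
  apply: EFin_inj; rewrite fineK; last first.
    rewrite ge0_fin_numE ?nneseries_ge0//.
    apply: (@le_lt_trans _ _ (\sum_(0 <= k <oo) f k)%E); last by rewrite -l1_normE ltry.
    rewrite (@nneseries_split _ _ 0 P)// add0n leeDr// sume_ge0//.
  rewrite l1_normE (@nneseries_split _ _ 0 P); last first.
    by move=> k _; rewrite lee_fin real_norm_ge0.
  rewrite add0n big1_seq ?add0e; last first.
    move=> i /andP[_]; rewrite mem_index_iota => /andP[_ it].
    by rewrite lp_funB truncateE it subrr real_norm0.
  apply: congr_lim; apply/funext => n; apply: eq_big_nat => t /andP[Pt _].
  by rewrite lp_funB truncateE ltnNge Pt subr0.
by apply: le_trans h; rewrite ler_norm.
Qed.

(** A weighted contraction of matrices acts on vectors of l2 coordinate by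
    coordinate, and the squared norms add up. *)
Lemma l2_contraction (I J : finType) (lam : I -> R) (mu : J -> R) (b : I -> J -> K)
    (v : J -> l2 R s) :
  (forall j, 0 <= lam j) -> (forall k, 0 <= mu k) ->
  (forall f : J -> K, \sum_j lam j * real_norm (\sum_k b j k * f k) ^+ 2 <=
     \sum_k mu k * real_norm (f k) ^+ 2) ->
  \sum_j lam j * real_norm (\sum_k b j k *: v k) ^+ 2 <=
     \sum_k mu k * real_norm (v k) ^+ 2.
Proof.
move=> lam0 mu0 H; rewrite -lee_fin -!sumEFin.
have E (L : finType) (c : L -> R) (u : L -> l2 R s) : (forall j, 0 <= c j) ->
    (\sum_j (c j * real_norm (u j) ^+ 2)%:E = \sum_(0 <= t <oo)
      \sum_j (c j * real_norm ((u j : lp s (ler1n R 2)) t) ^+ 2)%:E)%E.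
  move=> c0; rewrite nneseries_sum; last first.
    by move=> i j _; rewrite lee_fin mulr_ge0 ?sqr_ge0.
  apply: eq_bigr => j _; rewrite EFinM l2_normE -nneseriesZl//.
  by move=> t _; rewrite lee_fin sqr_ge0.
rewrite !E//; apply: lee_nneseries => [t _ _|t _].
  by rewrite sume_ge0// => j _; rewrite lee_fin mulr_ge0 ?sqr_ge0.
rewrite !sumEFin lee_fin; apply: le_trans (H (fun k => (v k : lp s (ler1n R 2)) t)).
apply: ler_sum => j _; rewrite lp_fun_sum.
by under eq_bigr do rewrite lp_funZ.
Qed.

End sequence_spaces.

(** * Multilinear maps and weakly summable sequences *)

Section multilinear_maps.
Context {R : realType} {s : scalar_kind} {m : nat}.
Local Notation K := (Defs.scalar R s).
Context {E F : normedModType K} (T : ('I_m -> E) -> F).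
Hypothesis HT : multilinear T.

Lemma multilinear_sum (J : finType) v (i : 'I_m) (c : J -> K) (u : J -> E) :
  T (dfwith v i (\sum_k c k *: u k)) = \sum_k c k *: T (dfwith v i (u k)).
Proof.
pose f : {linear E -> F} := HB.pack (fun u => T (dfwith v i u))
  (GRing.isLinear.Build K E F *:%R (fun u => T (dfwith v i u)) (HT v i)).
rewrite -[LHS]/(f _) linear_sum; apply: eq_bigr => k _.
by rewrite linearZ.
Qed.

Lemma multilinearB v (i : 'I_m) (u w : E) :
  T (dfwith v i (u - w)) = T (dfwith v i u) - T (dfwith v i w).
Proof.
pose f : {linear E -> F} := HB.pack (fun u => T (dfwith v i u))
  (GRing.isLinear.Build K E F *:%R (fun u => T (dfwith v i u)) (HT v i)).
by rewrite -[LHS]/(f _) linearB.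
Qed.

Lemma dfwith_eq (v w : 'I_m -> E) (i : 'I_m) :
  (forall j, i != j -> w j = v j) -> w = dfwith v i (w i).
Proof.
move=> h; apply/funext => j; have [<-|ij] := eqVneq i j; first by rewrite dfwithin.
by rewrite dfwithout// h.
Qed.

(** Telescoping: pass from v to w by changing one argument at a time. *)
Lemma multilinear_lipschitz (C : R) v w : 0 <= C ->
  (forall u, real_norm (T u) <= C * \prod_i real_norm (u i)) ->
  (forall i, real_norm (w i) <= real_norm (v i)) ->
  real_norm (T v - T w) <=
    C * \prod_i (1 + real_norm (v i)) * \sum_i real_norm (v i - w i).
Proof.
move=> C0 TC wv; pose h n (i : 'I_m) := if (i < n)%N then w i else v i.
set D := C * _.
have D0 : 0 <= D.
  by rewrite mulr_ge0// prodr_ge0// => i _; rewrite addr_ge0// real_norm_ge0.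
have H n : (n <= m)%N ->
    real_norm (T v - T (h n)) <= D * \sum_(i < m | (i < n)%N) real_norm (v i - w i).
  elim: n => [|n IHn] nm.
    by rewrite big_pred0// mulr0 (_ : h 0%N = v) ?subrr ?real_norm0//; apply/funext.
  pose i0 := Ordinal nm.
  have e1 : h n = dfwith (h n) i0 (v i0).
    by rewrite {1}(@dfwith_eq (h n) (h n) i0)// /h ltnn.
  have e2 : h n.+1 = dfwith (h n) i0 (w i0).
    rewrite {1}(@dfwith_eq (h n) (h n.+1) i0); first by rewrite {2}/h ltnSn.
    move=> j ij; rewrite /h ltnS leq_eqVlt.
    by rewrite (_ : (j == n :> nat) = false)//; apply: contraNF ij => /eqP jn; apply/eqP/val_inj.
  have -> : T v - T (h n.+1) = (T v - T (h n)) + T (dfwith (h n) i0 (v i0 - w i0)).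
    by rewrite multilinearB -e1 -e2 addrA subrK.
  apply: le_trans (real_normD _ _) _.
  rewrite (bigD1 i0)//= [leLHS]addrC mulrDr lerD//.
    apply: le_trans (TC _) _; rewrite /D -mulrA ler_wpM2l//.
    rewrite (bigD1 i0)//= dfwithin mulrC ler_wpM2r ?real_norm_ge0//.
    rewrite [leRHS](bigD1 i0)//= -[leLHS]mul1r ler_pM ?prodr_ge0//.
    - by move=> i _; rewrite real_norm_ge0.
    - by rewrite lerDl real_norm_ge0.
    - apply: ler_prod => i ii0; rewrite real_norm_ge0/= dfwithout 1?eq_sym//.
      by rewrite /h; case: ifP => _; rewrite ?lerDr// (le_trans (wv i))// lerDr.
  apply: le_trans (IHn (ltnW nm)) _; rewrite ler_wpM2l//.
  rewrite [leRHS](eq_bigl (fun i : 'I_m => (i < n)%N))// => i.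
  rewrite -(inj_eq val_inj) /= ltnS leq_eqVlt.
  by have [->|] := eqVneq; rewrite /= ?ltnn ?andbT.
have -> : w = h m by apply/funext => i; rewrite /h ltn_ord.
apply: le_trans (H m (leqnn m)) _; rewrite ler_wpM2l//.
rewrite le_eqVlt; apply/orP; left; apply/eqP; apply: eq_big => i; rewrite ltn_ord//.
by rewrite /h ltn_ord.
Qed.

End multilinear_maps.

Section weak_summability.
Context {R : realType} {s : scalar_kind}.
Local Notation K := (Defs.scalar R s).
Local Notation coord v t := ((v : lp s (lexx (1 : R))) t).

Lemma real_norm_sum (V : normedModType K) (J : finType) (u : J -> V) :
  real_norm (\sum_k u k) <= \sum_k real_norm (u k).
Proof.
elim/big_ind2 : _ => [|x1 x2 y1 y2 h1 h2|//]; first by rewrite real_norm0.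
by apply: le_trans (real_normD _ _) _; apply: lerD.
Qed.

Lemma real_norm_of_real (b : R) : real_norm (of_real s b) = `|b|.
Proof.
apply/eqP; rewrite -(eqrXn2 (n := 2)) ?real_norm_ge0//.
by rewrite real_norm_sqr of_realK im_part_of_real expr0n addr0 real_normK ?num_real.
Qed.

Lemma l1_partial_sum (P : nat) (v : l1 R s) :
  \sum_(k < P) real_norm (coord v k) <= real_norm v.
Proof.
rewrite -lee_fin l1_normE -sumEFin.
rewrite -(big_mkord xpredT (fun k => (real_norm (coord v k))%:E)).
by apply: nneseries_lim_ge => k _ _; rewrite lee_fin real_norm_ge0.
Qed.

(** A bounded sequence of coefficients t defines a functional in the dual unit
    ball of l1; real coefficients suffice in what follows. *)
Lemma weakly_summable_l1 (x : nat -> l1 R s) : weakly_summable x ->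
  exists2 A : R, 0 <= A & forall N P (t : 'I_P -> R), (forall k, `|t k| <= 1) ->
    \sum_(j < N) real_norm (\sum_(k < P) of_real s (t k) * coord (x j) k) <= A.
Proof.
rewrite /weakly_summable; set S := ereal_sup _ => Soo.
have S0 : (0 <= S)%E.
  apply: ereal_sup_ubound; exists (\0 : {linear l1 R s -> K^o}).
    by move=> v /=; rewrite real_norm0 real_norm_ge0.
  by rewrite eseries0// => j _ _; rewrite /= real_norm0.
exists (fine S); first exact: fine_ge0.
move=> N P t t1; rewrite -lee_fin fineK ?ge0_fin_numE//.
pose f (v : l1 R s) : K^o := \sum_(k < P) of_real s (t k) * coord v k.
have fl : linear f.
  move=> a u v; rewrite /f scaler_sumr -big_split /=; apply: eq_bigr => k _.
  transitivity (of_real s (t k) * (a * coord u k + coord v k)); first by [].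
  by rewrite mulrDr mulrCA.
pose phi : {linear l1 R s -> K^o} := HB.pack f
  (GRing.isLinear.Build K (l1 R s) K^o *:%R f fl).
have phi1 : dual_unit_ball phi.
  move=> v; rewrite -[phi v]/(f v) /f.
  apply: le_trans (real_norm_sum _) _; apply: le_trans (l1_partial_sum P v).
  apply: ler_sum => k _; rewrite real_normM real_norm_of_real -[leRHS]mul1r.
  by rewrite ler_wpM2r ?real_norm_ge0.
apply: le_trans (ereal_sup_ubound _); last by exists phi.
rewrite -sumEFin -(big_mkord xpredT (fun j => (real_norm (f (x j)))%:E)).
by apply: nneseries_lim_ge => k _ _; rewrite lee_fin real_norm_ge0.
Qed.

End weak_summability.

(** * Weighted square sums of multilinear maps *)

Section replace_coordinate.
Context {R : realType} {J : finType} {m : nat}.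

Definition replace (p : 'I_m) (j : {ffun 'I_m -> J}) (t : J) : {ffun 'I_m -> J} :=
  [ffun i => if i == p then t else j i].

(** The map (j, t) |-> (j with its p-th entry replaced by t, j p) is an
    involution, so every index is reached equally often. *)
Lemma sum_replace (p : 'I_m) (F : {ffun 'I_m -> J} -> R) :
  \sum_j \sum_t F (replace p j t) = #|J|%:R * \sum_j F j.
Proof.
rewrite pair_big /=.
pose h (q : {ffun 'I_m -> J} * J) := (replace p q.1 q.2, q.1 p).
have hK : involutive h.
  move=> [j t]; rewrite /h /= /replace ffunE eqxx; congr (_, _).
  by apply/ffunP => i; rewrite !ffunE; case: eqP => // ->.
rewrite (reindex_inj (inv_inj hK)) /=.
rewrite (eq_bigr (fun q : {ffun 'I_m -> J} * J => F q.1)); last first.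
  by move=> q _; have /(congr1 fst) /= := hK q => ->.
rewrite -(pair_big xpredT xpredT (fun j _ => F j)) /= mulr_sumr.
by apply: eq_bigr => j _; rewrite sumr_const mulr_natl.
Qed.

(** A comparison of sums over multi-indices can be made one coordinate at a
    time. *)
Lemma ler_sum_replace (p : 'I_m) (F G : {ffun 'I_m -> J} -> R) :
  (forall j, \sum_t F (replace p j t) <= \sum_t G (replace p j t)) ->
  \sum_j F j <= \sum_j G j.
Proof.
move=> FG; have [J0|] := posnP #|J|.
  by rewrite !big1// => j; have := fintype0 (j p) J0.
rewrite -(ltr_nat R) => J0.
by rewrite -(ler_pM2l J0) -!(sum_replace p); apply: ler_sum.
Qed.

End replace_coordinate.

Section multiple_summability.
Context {R : realType} {s : scalar_kind} {m : nat}.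
Local Notation K := (Defs.scalar R s).
Local Notation coord v t := ((v : lp s (lexx (1 : R))) t).
Variables (T : ('I_m -> l1 R s) -> l2 R s) (C : R).
Hypotheses (HT : multilinear T) (C0 : 0 <= C).
Hypothesis TC : forall v, real_norm (T v) <= C * \prod_i real_norm (v i).

(** The matrices are applied to the coordinates one after the other.  At stage
    n, the first n arguments of T are truncated x's, weighted by 1 / lam, and the
    others are unit vectors, weighted by mu; by [l2_contraction] the weighted
    sum of squares decreases from each stage to the next.  At stage 0 it is
    bounded by the total mass of mu. *)
Lemma weighted_multiple_sum P (lam mu : 'I_P -> R) (x : 'I_m -> nat -> l1 R s) :
  (forall j, 0 < lam j) -> (forall k, 0 <= mu k) ->
  (forall i (f : 'I_P -> K),
    \sum_j (lam j)^-1 * real_norm (\sum_(k < P) coord (x i j) k * f k) ^+ 2 <=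
    \sum_k mu k * real_norm (f k) ^+ 2) ->
  \sum_(j : {ffun 'I_m -> 'I_P}) (\prod_i (lam (j i))^-1) *
     real_norm (T (fun i => truncate P (x i (j i)))) ^+ 2 <=
  C ^+ 2 * (\sum_k mu k) ^+ m.
Proof.
move=> lam0 mu0 H.
pose w n (j : {ffun 'I_m -> 'I_P}) (i : 'I_m) : R :=
  if (i < n)%N then (lam (j i))^-1 else mu (j i).
pose z n (j : {ffun 'I_m -> 'I_P}) (i : 'I_m) : l1 R s :=
  if (i < n)%N then truncate P (x i (j i)) else unit_vector (j i).
pose Q n := \sum_(j : {ffun 'I_m -> 'I_P}) (\prod_i w n j i) * real_norm (T (z n j)) ^+ 2.
have Qstep n : (n < m)%N -> Q n.+1 <= Q n.
  move=> nm; pose p := Ordinal nm.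
  apply: (@ler_sum_replace _ _ _ p) => j.
  pose W := \prod_(i | i != p) w n j i.
  have W0 : 0 <= W.
    by apply: prodr_ge0 => i _; rewrite /w; case: ifP => // _; rewrite invr_ge0 ltW.
  have ltSp i : i != p -> (i < n.+1)%N = (i < n)%N.
    move=> ip; rewrite ltnS leq_eqVlt; suff -> : (i == n :> nat) = false by [].
    by apply: contraNF ip => /eqP e; apply/eqP/val_inj.
  have Wn t : \prod_i w n (replace p j t) i = mu t * W.
    rewrite (bigD1 p)//= {1}/w ltnn ffunE eqxx; congr (_ * _).
    by apply: eq_bigr => i /negPf ip; rewrite /w ffunE ip.
  have WS t : \prod_i w n.+1 (replace p j t) i = (lam t)^-1 * W.
    rewrite (bigD1 p)//= {1}/w ltnSn ffunE eqxx; congr (_ * _).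
    by apply: eq_bigr => i ip; rewrite /w ffunE (negPf ip) ltSp.
  have zn t : z n (replace p j t) = dfwith (z n j) p (unit_vector t).
    rewrite (@dfwith_eq _ _ _ _ (z n j) (z n (replace p j t)) p).
      by rewrite {2}/z ltnn ffunE eqxx.
    by move=> i ip; rewrite /z ffunE eq_sym (negPf ip).
  have zS t : z n.+1 (replace p j t) = dfwith (z n j) p (truncate P (x p t)).
    rewrite (@dfwith_eq _ _ _ _ (z n j) (z n.+1 (replace p j t)) p).
      by rewrite {2}/z ltnSn ffunE eqxx.
    by move=> i ip; rewrite eq_sym in ip; rewrite /z ffunE (negPf ip) ltSp.
  under eq_bigr => t _ do rewrite WS zS /truncate multilinear_sum// mulrAC.
  under [leRHS]eq_bigr => t _ do rewrite Wn zn mulrAC.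
  rewrite -!mulr_suml ler_wpM2r//.
  apply: (l2_contraction (b := fun j k : 'I_P => coord (x p j) k)
    (fun k : 'I_P => T (dfwith (z n j) p (unit_vector k)))) => //.
  by move=> t; rewrite invr_ge0 ltW.
have Qm n : (n <= m)%N -> Q n <= Q 0%N.
  elim: n => // n IHn nm; apply: le_trans (Qstep _ nm) (IHn (ltnW nm)).
have -> : \sum_(j : {ffun 'I_m -> 'I_P}) (\prod_i (lam (j i))^-1) *
     real_norm (T (fun i => truncate P (x i (j i)))) ^+ 2 = Q m.
  apply: eq_bigr => j _; rewrite /w /z; congr (_ * real_norm (T _) ^+ 2).
    by apply: eq_bigr => i _; rewrite ltn_ord.
  by apply/funext => i; rewrite ltn_ord.
apply: le_trans (Qm _ (leqnn m)) _.
have -> : (\sum_k mu k) ^+ m = \prod_(i < m) \sum_k mu k by rewrite prodr_const card_ord.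
rewrite bigA_distr_bigA mulr_sumr; apply: ler_sum => j _.
rewrite /w /= mulrC ler_wpM2r ?prodr_ge0// ler_pXn2r ?nnegrE ?real_norm_ge0//.
apply: le_trans (TC _) _; rewrite big1 ?mulr1// => i _.
by rewrite /z ltn0 real_norm_unit_vector.
Qed.

(** The bound M has to be independent of the truncation order P, although the
    weights are not. *)
Lemma multiple_summability (x : 'I_m -> nat -> l1 R s) :
  (forall i, weakly_summable (x i)) ->
  exists M : R, forall P, exists lam : 'I_P -> R,
  [/\ forall j, 0 < lam j, \sum_j lam j <= 1 &
  \sum_(j : {ffun 'I_m -> 'I_P}) (\prod_i (lam (j i))^-1) *
     real_norm (T (fun i => truncate P (x i (j i)))) ^+ 2 <= M].
Proof.
move=> xw.
have /choice[A HA] : forall i, exists A : R, 0 <= A /\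
    forall N P (t : 'I_P -> R), (forall k, `|t k| <= 1) ->
    \sum_(j < N) real_norm (\sum_(k < P) of_real s (t k) * coord (x i j) k) <= A.
  by move=> i; have [A A0 HA] := weakly_summable_l1 (xw i); exists A.
pose A1 := \sum_i A i.
have A10 : 0 <= A1 by apply: sumr_ge0 => i _; have [] := HA i.
exists (C ^+ 2 * (4 * weight_bound (#|'I_m| * 2) A1) ^+ m) => P.
have [|lam [mu [lam0 lam1 mu0 muM H]]] :=
  @scalar_weights R s 'I_m 'I_P 'I_P (fun i (j k : 'I_P) => coord (x i j) k) A1 A10.
  move=> i t t1; have [_ /(_ P P t t1) h] := HA i; apply: le_trans h _.
  by rewrite /A1 (bigD1 i)//= lerDl sumr_ge0// => i' _; have [] := HA i'.
exists lam; split => //.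
apply: le_trans (weighted_multiple_sum lam0 mu0 H) _.
by rewrite ler_wpM2l ?sqr_ge0// lerXn2r// nnegrE ?sumr_ge0// (le_trans _ muM)// sumr_ge0.
Qed.

End multiple_summability.

(** * From square sums to the exponent 2/(n+1) *)

Section summation_exponent.
Context {R : realType}.

(** Writing a for p^-1 t^2 and b for the n-th root of p, we have t^2 = a b^n,
    which is at most (a + b)^(n+1). *)
Lemma powR_le_weighted (n : nat) (p t : R) : (0 < n)%N -> 0 < p -> 0 <= t ->
  t `^ (2 / (n%:R + 1)) <= p^-1 * t ^+ 2 + p `^ n%:R^-1.
Proof.
move=> n0 p0 t0; set b := p `^ n%:R^-1; set a := p^-1 * t ^+ 2.
have b0 : 0 <= b by rewrite powR_ge0.
have a0 : 0 <= a by rewrite mulr_ge0 ?sqr_ge0// invr_ge0 ltW.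
have bn : b ^+ n = p.
  by rewrite -powR_mulrn// /b -powRrM mulVf ?powRr1 ?(ltW p0)// pnatr_eq0 -lt0n.
have t2 : t ^+ 2 = a * b ^+ n by rewrite bn /a mulrC mulrA mulfV ?mul1r// gt_eqF.
rewrite powRrM powR_mulrn// t2.
have -> : a + b = ((a + b) ^+ n.+1) `^ (n%:R + 1)^-1.
  rewrite -powR_mulrn ?addr_ge0// -powRrM natr1 mulfV ?pnatr_eq0// powRr1 ?addr_ge0//.
have anb : a * b ^+ n <= (a + b) ^+ n.+1.
  by rewrite exprS ler_pM ?exprn_ge0// ?lerDl// lerXn2r ?nnegrE ?addr_ge0 ?lerDr.
apply: ge0_ler_powR anb; rewrite ?nnegrE.
- by rewrite invr_ge0 addr_ge0.
- by rewrite mulr_ge0 ?exprn_ge0.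
- by rewrite exprn_ge0 ?addr_ge0.
Qed.

(** On the diagonal of a block with c >= n elements, the product of the weights
    is lam^c <= lam^n, so its n-th root is at most lam.  The admissible indices are
    determined by their values at one representative of each block, and the sum
    over these values factors into k sums of total weight at most 1. *)
Lemma sum_diagonal_weights (m k P n : nat) (I : 'I_k -> {set 'I_m}) (lam : 'I_P -> R) :
  (0 < n)%N -> (forall l, n <= #|I l|)%N ->
  (forall l l', l != l' -> [disjoint I l & I l']) ->
  (\bigcup_(l < k) I l)%SET = [set: 'I_m]%SET ->
  (forall j, 0 < lam j) -> \sum_j lam j <= 1 ->
  \sum_(j : {ffun 'I_m -> 'I_P} |
      [forall l, forall a in I l, forall b in I l, j a == j b])
    (\prod_i lam (j i)) `^ n%:R^-1 <= 1.
Proof.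
move=> n0 nI Idisj Icov lam0 lam1.
have lamle1 j : lam j <= 1.
  apply: le_trans lam1; rewrite (bigD1 j)//= lerDl sumr_ge0// => *; exact: ltW.
have /choice[rep repI] : forall l, exists a, a \in I l.
  by move=> l; apply/card_gt0P; exact: leq_trans (nI l).
pose ok (j : {ffun 'I_m -> 'I_P}) :=
  [forall l, forall a in I l, forall b in I l, j a == j b].
pose h (j : {ffun 'I_m -> 'I_P}) := [ffun l => j (rep l)].
have ok_rep j l a : ok j -> a \in I l -> j a = j (rep l).
  by move=> /forallP/(_ l)/forall_inP h1 /h1 /forall_inP/(_ _ (repI l))/eqP.
have h_inj : {in [set j | ok j] &, injective h}.
  move=> j j'; rewrite !inE => jok j'ok /ffunP e; apply/ffunP => a.
  have : a \in (\bigcup_(l < k) I l)%SET by rewrite Icov inE.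
  case/bigcupP => l _ al; rewrite (ok_rep _ _ _ jok al) (ok_rep _ _ _ j'ok al).
  by have := e l; rewrite !ffunE.
have G0 (j' : {ffun 'I_k -> 'I_P}) : 0 <= \prod_l lam (j' l).
  by apply: prodr_ge0 => l _; exact: ltW.
apply: (@le_trans _ _ (\sum_(j in [set j | ok j]) \prod_l lam (h j l))).
  rewrite [leRHS](eq_bigl ok); last by move=> j; rewrite inE.
  apply: ler_sum => j jok.
  have -> : \prod_l lam (h j l) = ((\prod_l lam (h j l)) ^+ n) `^ n%:R^-1.
    by rewrite -powR_mulrn// -powRrM mulfV ?powRr1// pnatr_eq0 -lt0n.
  rewrite ge0_ler_powR ?nnegrE ?exprn_ge0//.
    by apply: prodr_ge0 => i _; exact: ltW.
  rewrite -prodrXl (eq_bigl (fun i => i \in (\bigcup_(l < k) I l)%SET)); last first.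
    by move=> i; rewrite Icov inE.
  rewrite partition_disjoint_bigcup//; apply: ler_prod => l _.
  rewrite prodr_ge0/=; last by move=> i _; exact: ltW.
  rewrite (eq_bigr (fun=> lam (h j l))); last first.
    by move=> i il; rewrite /h ffunE (ok_rep _ _ _ jok il).
  by rewrite prodr_const ler_wiXn2l ?lamle1 ?(ltW (lam0 _)).
rewrite -(big_imset (fun j' : {ffun 'I_k -> 'I_P} => \prod_l lam (j' l)) h_inj).
apply: (@le_trans _ _ (\sum_(j' : {ffun 'I_k -> 'I_P}) \prod_l lam (j' l))).
  by rewrite [leRHS](bigID (mem (h @: [set j | ok j])))/= lerDl sumr_ge0.
rewrite -(bigA_distr_bigA (fun _ => lam)) prodr_const exprn_ile1// sumr_ge0// => j _.
exact: ltW.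
Qed.

Lemma ler_sum_subset (L : eqType) (a b : seq L) (G : L -> R) :
  (forall x, 0 <= G x) -> uniq a -> uniq b -> {subset a <= b} ->
  \sum_(x <- a) G x <= \sum_(x <- b) G x.
Proof.
move=> G0 ua ub ab; rewrite [leRHS](bigID (mem a))/= -[X in _ <= X + _]big_filter.
rewrite [X in _ <= X + _](perm_big a)/=; first by rewrite lerDl sumr_ge0.
apply: uniq_perm => //; first exact: filter_uniq.
by move=> x; rewrite mem_filter; case: (boolP (x \in a)) => //= /ab.
Qed.

Lemma near_all_seq (L : eqType) (a : seq L) (Q : L -> nat -> Prop) :
  (forall x, x \in a -> \forall P \near \oo%classic, Q x P) ->
  \forall P \near \oo%classic, forall x, x \in a -> Q x P.
Proof.
elim: a => [|y a IHa] h; first by apply: nearW => P x; rewrite in_nil.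
have h1 : \forall P \near \oo%classic, forall x, x \in a -> Q x P.
  by apply: IHa => x xa; apply: h; rewrite in_cons xa orbT.
have := h y (mem_head _ _); move: h1; apply: filterS2 => P h1 h2 x.
by rewrite in_cons => /orP[/eqP ->//|]; exact: h1.
Qed.

End summation_exponent.

Section inclusion.
Context {R : realType} {s : scalar_kind} {m : nat}.

(** The factor 2 spares a passage to the limit: truncated values approximate the
    value at v, so they eventually exceed half of it. *)
Lemma near_truncation (T : ('I_m -> l1 R s) -> l2 R s) (v : 'I_m -> l1 R s) :
  bounded_multilinear T ->
  \forall P \near \oo%classic,
    real_norm (T v) <= 2 * real_norm (T (fun i => truncate P (v i))).
Proof.
move=> [HT [C TC]].
have [Tv0|Tv0] := eqVneq (real_norm (T v)) 0.
  by apply: nearW => P; rewrite Tv0 mulr_ge0 ?real_norm_ge0.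
pose D := `|C| * \prod_i (1 + real_norm (v i)).
have D0 : 0 <= D.
  by rewrite mulr_ge0// prodr_ge0// => i _; rewrite addr_ge0// real_norm_ge0.
pose e := real_norm (T v) / 2 / (1 + D * m%:R).
have d0 : 0 < 1 + D * m%:R by rewrite ltr_pwDl// mulr_ge0.
have e0 : 0 < e by rewrite !divr_gt0// lt_neqAle eq_sym Tv0 real_norm_ge0.
have : \forall P \near \oo%classic, forall i, real_norm (v i - truncate P (v i)) <= e.
  by apply: filter_forall => i; exact: truncate_cvg.
apply: filterS => P h.
have TC' u : real_norm (T u) <= `|C| * \prod_i real_norm (u i).
  apply: le_trans (TC u) _; rewrite ler_wpM2r ?ler_norm// prodr_ge0// => i _.
  exact: real_norm_ge0.
have := multilinear_lipschitz HT (normr_ge0 C) TC' (fun i => real_norm_truncate P (v i)).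
rewrite -/D => h1.
have h2 : D * \sum_i real_norm (v i - truncate P (v i)) <= real_norm (T v) / 2.
  apply: (@le_trans _ _ (D * (m%:R * e))).
    rewrite ler_wpM2l//; apply: (@le_trans _ _ (\sum_(i < m) e)); first exact: ler_sum.
    by rewrite sumr_const card_ord mulr_natl.
  rewrite mulrA /e mulrA ler_pdivrMr// mulrC ler_wpM2l ?divr_ge0 ?real_norm_ge0//.
  by rewrite lerDr.
have := real_normD (T v - T (fun i => truncate P (v i))) (T (fun i => truncate P (v i))).
rewrite subrK; lra.
Qed.

(** A finite partial sum involves finitely many indices, so it is controlled, at
    a large enough order of truncation, by the finite estimate. *)
Lemma bounded_multilinear_summing (k n : nat) (I : 'I_k -> {set 'I_m})
    (T : ('I_m -> l1 R s) -> l2 R s) :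
  (0 < n)%N -> (forall l, n <= #|I l|)%N ->
  (forall l l', l != l' -> [disjoint I l & I l']) ->
  (\bigcup_(l < k) I l)%SET = [set: 'I_m]%SET ->
  bounded_multilinear T -> abs_summing I (2 / (n%:R + 1)) T.
Proof.
move=> n0 nI Idisj Icov Tb; split => // x xw.
have [HT [C TC]] := Tb.
have TC' u : real_norm (T u) <= `|C| * \prod_i real_norm (u i).
  apply: le_trans (TC u) _; rewrite ler_wpM2r ?ler_norm// prodr_ge0// => i _.
  exact: real_norm_ge0.
have [M HM] := multiple_summability HT (normr_ge0 C) TC' xw.
set r := 2 / (n%:R + 1).
have nR : 1 <= n%:R :> R by rewrite ler1n.
have r0 : 0 <= r by rewrite divr_ge0.
have r1 : r <= 1 by rewrite ler_pdivrMr; lra.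
apply: (@le_lt_trans _ _ (2 * (M + 1))%:E); last exact: ltry.
apply: ge_ereal_sup => _ [X [finX XO] <-].
rewrite fsbig_finite// sumEFin lee_fin.
set X' := finmap.enum_fset _.
have XX' j : j \in X' -> Omega I j.
  by move=> jX; apply: XO; move: jX; rewrite in_fset_set// inE.
have [P HP] : exists P : nat, forall j, j \in X' -> (forall i, (j i < P)%N) /\
    real_norm (T (fun i => x i (j i))) <=
    2 * real_norm (T (fun i => truncate P (x i (j i)))).
  have : \forall P \near \oo%classic, forall j, j \in X' -> (forall i, (j i < P)%N) /\
      real_norm (T (fun i => x i (j i))) <=
      2 * real_norm (T (fun i => truncate P (x i (j i)))).
    apply: near_all_seq => j _.
    have : \forall P \near \oo%classic, forall i, (j i < P)%N.
      by apply: filter_forall => i; exists (j i).+1.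
    move: (near_truncation (fun i => x i (j i)) Tb); apply: filterS2 => P h1 h2.
    exact: conj.
  by case=> P _ HP; exists P; exact: (HP P (leqnn P)).
have [lam [lam0 lam1 HL]] := HM P.
pose ok (j : {ffun 'I_m -> 'I_P}) :=
  [forall l, forall a in I l, forall b in I l, j a == j b].
pose up (j : {ffun 'I_m -> 'I_P}) : {ffun 'I_m -> nat} := [ffun i => val (j i)].
pose tau (j : {ffun 'I_m -> nat}) := real_norm (T (fun i => truncate P (x i (j i)))).
have tau0 j : 0 <= tau j by exact: real_norm_ge0.
have up_inj : injective up.
  by move=> j j' /ffunP e; apply/ffunP => i; have := e i; rewrite !ffunE => /val_inj.
apply: (@le_trans _ _ (\sum_(j <- X') 2 * tau j `^ r)).
  rewrite !big_seq; apply: ler_sum => j jX; have [_ h] := HP j jX.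
  apply: le_trans (_ : (2 * tau j) `^ r <= _).
    by rewrite ge0_ler_powR ?nnegrE ?mulr_ge0 ?real_norm_ge0.
  by rewrite powRM// ler_wpM2r ?powR_ge0// ler1_powR// ler1n.
rewrite -mulr_sumr ler_wpM2l//.
apply: (@le_trans _ _ (\sum_(j | ok j) tau (up j) `^ r)).
  have -> : \sum_(j | ok j) tau (up j) `^ r =
      \sum_(j <- [seq up j | j <- enum [pred j | ok j]]) tau j `^ r.
    by rewrite big_map big_enum.
  apply: ler_sum_subset => [j|||j jX]; first exact: powR_ge0.
  - exact: finmap.fset_uniq.
  - by rewrite map_inj_uniq// enum_uniq.
  have [jP _] := HP j jX; apply/mapP; exists [ffun i => Ordinal (jP i)].
    rewrite mem_enum inE; apply/forallP => l.
    apply/forall_inP => a al; apply/forall_inP => b bl; rewrite !ffunE.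
    by apply/eqP/val_inj => /=; exact: (XX' _ jX l).
  by apply/ffunP => i; rewrite !ffunE.
apply: (@le_trans _ _ (\sum_(j | ok j) ((\prod_i lam (j i))^-1 * tau (up j) ^+ 2 +
    (\prod_i lam (j i)) `^ n%:R^-1))).
  apply: ler_sum => j _; apply: powR_le_weighted => //.
  by apply: prodr_gt0.
rewrite big_split /= lerD//; last exact: sum_diagonal_weights.
apply: le_trans HL; rewrite [leRHS](bigID ok)/= -[leLHS]addr0 lerD//.
  apply: ler_sum => j _; rewrite prodfV /tau.
  rewrite le_eqVlt; apply/orP; left; apply/eqP; congr (_ * real_norm (T _) ^+ 2).
  by apply/funext => i; rewrite ffunE.
apply: sumr_ge0 => j _; rewrite mulr_ge0 ?sqr_ge0// prodr_ge0// => i _.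
by rewrite invr_ge0 ltW.
Qed.

End inclusion.

(** * Sums over dyadic blocks *)

Section dyadic_blocks.

(** The index q stands for the pair (level q, offset q), the numbers with level
    d being the 2 ^ d consecutive integers from 2 ^ d - 1 on. *)
Definition level (q : nat) : nat := trunc_log 2 q.+1.

Definition offset (q : nat) : nat := (q.+1 - 2 ^ level q)%N.

Lemma level_block d u : (u < 2 ^ d)%N ->
  level ((2 ^ d).-1 + u) = d /\ offset ((2 ^ d).-1 + u) = u.
Proof.
move=> ud; have d0 : (0 < 2 ^ d)%N by rewrite expn_gt0.
have e : ((2 ^ d).-1 + u).+1 = (2 ^ d + u)%N by rewrite -addSn prednK.
have h : level ((2 ^ d).-1 + u) = d.
  rewrite /level e; apply: trunc_log_eq => //.
  by rewrite leq_addr expnS mul2n -addnn ltn_add2l.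
by split => //; rewrite /offset h e addKn.
Qed.

Lemma sum_dyadic (R : realType) (F : nat -> nat -> R) D :
  \sum_(0 <= q < (2 ^ D).-1) F (level q) (offset q) =
  \sum_(d < D) \sum_(u < 2 ^ d) F d u.
Proof.
elim: D => [|D IHD]; first by rewrite big_ord0 big_geq.
have D0 : (0 < 2 ^ D)%N by rewrite expn_gt0.
have e : (2 ^ D.+1).-1 = ((2 ^ D).-1 + 2 ^ D)%N.
  by rewrite expnS mul2n -addnn -{1}(prednK D0).
rewrite (@big_cat_nat _ _ _ (2 ^ D).-1)//=; last by rewrite e leq_addr.
rewrite IHD big_ord_recr /=; congr (_ + _).
rewrite -{1}[(2 ^ D).-1]add0n big_addn e addKn big_mkord; apply: eq_bigr => u _.
by rewrite addnC; have [-> ->] := level_block (ltn_ord u).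
Qed.

Lemma dyadic_series_le (R : realType) (f : nat -> R) (c : R) :
  (forall q, 0 <= f q) ->
  (forall D, \sum_(0 <= q < (2 ^ D).-1) f q <= c) ->
  (\sum_(0 <= q <oo) (f q)%:E <= c%:E)%E.
Proof.
move=> f0 fc; apply: lime_le.
  by apply: is_cvg_nneseries => q _ _; rewrite lee_fin.
apply: nearW => n; rewrite sumEFin lee_fin; apply: le_trans (fc n).
have n2 : (n <= (2 ^ n).-1)%N by rewrite -ltnS prednK ?expn_gt0// ltn_expl.
by rewrite [leRHS](@big_cat_nat _ _ _ n)//= lerDl sumr_ge0.
Qed.

Lemma geometric_sum_le (R : realType) (a : R) D : 0 <= a -> a < 1 ->
  \sum_(d < D) a ^+ d <= (1 - a)^-1.
Proof.
move=> a0 a1; have h : 0 < 1 - a by rewrite subr_gt0.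
rewrite -[leRHS]mul1r ler_pdivlMr// mulrC -[in leLHS]opprB mulNr -subrX1 opprB.
by rewrite lerBlDr lerDl exprn_ge0.
Qed.

End dyadic_blocks.

(** * Walsh matrices *)

Section Walsh.
Context {R : realType} {s : scalar_kind}.
Local Notation K := (Defs.scalar R s).
Local Notation coord v t := ((v : lp s (lexx (1 : R))) t).
Local Notation coord2 v t := ((v : lp s (ler1n R 2)) t).

Fixpoint walsh (d u t : nat) : R :=
  if d is d'.+1 then (-1) ^+ (odd u && odd t) * walsh d' u./2 t./2 else 1.

Lemma walsh_sqr d u t : walsh d u t * walsh d u t = 1.
Proof.
elim: d u t => [|d IHd] u t /=; first by rewrite mulr1.
by rewrite mulrACA IHd mulr1 -expr2 sqrr_sign.
Qed.

Lemma walshE d u t :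
  [/\ walsh d.+1 u.*2 t.*2 = walsh d u t, walsh d.+1 u.*2 t.*2.+1 = walsh d u t,
      walsh d.+1 u.*2.+1 t.*2 = walsh d u t &
      walsh d.+1 u.*2.+1 t.*2.+1 = - walsh d u t].
Proof.
by split; rewrite /= ?uphalf_double ?doubleK odd_double/= ?odd_double/= ?expr0 ?expr1 ?mul1r ?mulN1r.
Qed.

Lemma of_real1 : of_real s (1 : R) = 1.
Proof. by case: s. Qed.

Lemma of_realN (a : R) : of_real s (- a) = - of_real s a.
Proof. by case: s => //=; rewrite rmorphN. Qed.

Lemma of_realX (a : R) n : of_real s (a ^+ n) = of_real s a ^+ n.
Proof. by elim: n => [|n IHn]; rewrite ?of_real1// !exprS of_realM IHn. Qed.

Lemma parallelogram (y z : K) :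
  real_norm (y + z) ^+ 2 + real_norm (y - z) ^+ 2 =
  2 * (real_norm y ^+ 2 + real_norm z ^+ 2).
Proof.
have reN (a : K) : real_part (- a) = - real_part a by case: s a => //= -[].
have imN (a : K) : im_part (- a) = - im_part a.
  by rewrite /im_part; case: s a => /= [a|[]//]; rewrite oppr0.
by rewrite !real_norm_sqr !real_partD !im_partD reN imN; ring.
Qed.

(** One step of the fast Walsh transform: splitting u and t by parity, the pair
    of rows 2u', 2u'+1 applies the smaller matrix to the sums and to the
    differences of consecutive entries. *)
Lemma walsh_Parseval d (f : nat -> K) :
  \sum_(u < 2 ^ d) real_norm (\sum_(t < 2 ^ d) of_real s (walsh d u t) * f t) ^+ 2 =
  2 ^+ d * \sum_(t < 2 ^ d) real_norm (f t) ^+ 2.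
Proof.
elim: d f => [|d IHd] f.
  by rewrite expn0 !big_ord_recr !big_ord0 /= ?expr0 !add0r of_real1 !mul1r.
rewrite expnS mul2n.
rewrite (sum_ord_double (fun u => real_norm
  (\sum_(t < (2 ^ d).*2) of_real s (walsh d.+1 u t) * f t) ^+ 2)).
rewrite (sum_ord_double (fun t => real_norm (f t) ^+ 2)).
have e0 (u : nat) : \sum_(t < (2 ^ d).*2) of_real s (walsh d.+1 u.*2 t) * f t =
    \sum_(t < 2 ^ d) of_real s (walsh d u t) * (f t.*2 + f t.*2.+1).
  rewrite (sum_ord_double (fun t => of_real s (walsh d.+1 u.*2 t) * f t)).
  by apply: eq_bigr => t _; have [-> -> _ _] := walshE d u t; rewrite mulrDr.
have e1 (u : nat) : \sum_(t < (2 ^ d).*2) of_real s (walsh d.+1 u.*2.+1 t) * f t =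
    \sum_(t < 2 ^ d) of_real s (walsh d u t) * (f t.*2 - f t.*2.+1).
  rewrite (sum_ord_double (fun t => of_real s (walsh d.+1 u.*2.+1 t) * f t)).
  apply: eq_bigr => t _; have [_ _ -> ->] := walshE d u t.
  by rewrite mulrBr of_realN mulNr.
under eq_bigr => u _ do rewrite e0 e1.
rewrite big_split /= (IHd (fun t => f t.*2 + f t.*2.+1)) (IHd (fun t => f t.*2 - f t.*2.+1)).
rewrite -mulrDr -big_split /= exprSr -mulrA; congr (_ * _); rewrite mulr_sumr.
by apply: eq_bigr => t _; exact: parallelogram.
Qed.

(** The norm of the Walsh matrix from l_infty to l1, by Cauchy-Schwarz and
    Parseval. *)
Lemma walsh_sum_le d (f : nat -> K) : (forall t, real_norm (f t) <= 1) ->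
  \sum_(u < 2 ^ d) real_norm (\sum_(t < 2 ^ d) of_real s (walsh d u t) * f t) <=
  2 ^+ d * Num.sqrt 2 ^+ d.
Proof.
move=> f1; set N : R := 2 ^+ d; set h := Num.sqrt 2 ^+ d.
have h0 : 0 < h by rewrite exprn_gt0// sqrtr_gt0.
have N0 : 0 <= N by rewrite exprn_ge0.
have hN : h ^+ 2 = N by rewrite /h exprAC sqr_sqrtr.
have P : \sum_(u < 2 ^ d) real_norm (\sum_(t < 2 ^ d) of_real s (walsh d u t) * f t) ^+ 2
    <= N ^+ 2.
  rewrite walsh_Parseval -/N expr2 ler_wpM2l//.
  apply: (@le_trans _ _ (\sum_(t < 2 ^ d) 1)); last by rewrite sumr_const card_ord /N -natrX.
  by apply: ler_sum => t _; rewrite exprn_ile1// real_norm_ge0.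
apply: (@le_trans _ _ (\sum_(u < 2 ^ d)
   (h^-1 * real_norm (\sum_(t < 2 ^ d) of_real s (walsh d u t) * f t) ^+ 2 + h) / 2)).
  apply: ler_sum => u _; set y := real_norm _.
  have := sqr_ge0 (y - h); have -> : h^-1 * y ^+ 2 + h = h^-1 * (y ^+ 2 + h ^+ 2).
    by field; rewrite gt_eqF.
  move=> yh; rewrite mulrAC -mulrA [leRHS]mulrC ler_pdivlMr// ler_pdivlMl//; nra.
rewrite -mulr_suml big_split /= -mulr_sumr sumr_const card_ord -[h *+ _]mulr_natl natrX -/N.
have : h^-1 * \sum_(u < 2 ^ d) real_norm (\sum_(t < 2 ^ d) of_real s (walsh d u t) * f t) ^+ 2
    <= h^-1 * N ^+ 2 by rewrite ler_wpM2l// invr_ge0 ltW.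
have -> : h^-1 * N ^+ 2 = N * h by rewrite -hN; field; rewrite gt_eqF.
lra.
Qed.

End Walsh.

(** * A bounded operator that is not summing *)

Section optimality.
Context {R : realType} {s : scalar_kind} {m : nat}.
Local Notation K := (Defs.scalar R s).
Local Notation coord v t := ((v : lp s (lexx (1 : R))) t).
Local Notation coord2 v t := ((v : lp s (ler1n R 2)) t).
Variables (B : {set 'I_m}) (rho : R).
Hypotheses (rho_gt0 : 0 < rho) (rho_lt : 2 * rho ^+ 2 < 1).

Lemma l1_coord_le (v : l1 R s) t : real_norm (coord v t) <= real_norm v.
Proof.
apply: le_trans (l1_partial_sum t.+1 v).
by rewrite big_ord_recr /= lerDr sumr_ge0// => k _; exact: real_norm_ge0.
Qed.

Lemma l2_coord_le (v : l2 R s) t : real_norm (coord2 v t) <= real_norm v.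
Proof.
rewrite -(ler_pXn2r (n := 2)) ?nnegrE ?real_norm_ge0// -lee_fin l2_normE.
apply: le_trans (nneseries_lim_ge t.+1 _); last by move=> k _ _; rewrite lee_fin sqr_ge0.
rewrite big_nat_recr//= leeDr// sume_ge0// => k _; by rewrite lee_fin sqr_ge0.
Qed.

Definition walsh_coefficient (q : nat) (v : l1 R s) : K :=
  \sum_(t < 2 ^ level q) of_real s (walsh (level q) (offset q) t) * coord v t.

(** Arguments outside of B enter through their coordinate 0 only, which allows
    them to be kept constant in [test_sequence]. *)
Definition factor (q : nat) (i : 'I_m) (v : l1 R s) : K :=
  if i \in B then walsh_coefficient q v else coord v 0%N.

Lemma walsh_norm d u t : `|walsh d u t : R| = 1.
Proof.
by apply/eqP; rewrite -(eqrXn2 (n := 2))// expr1n real_normK ?num_real// expr2 walsh_sqr.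
Qed.

Lemma factor_linear q i (a : K) (v w : l1 R s) :
  factor q i (a *: v + w) = a * factor q i v + factor q i w.
Proof.
rewrite /factor /walsh_coefficient; case: ifP => _; last by [].
rewrite mulr_sumr -big_split /=; apply: eq_bigr => t _.
rewrite mulrCA -mulrDr; by [].
Qed.

Lemma factor_le q i (v : l1 R s) : real_norm (factor q i v) <= real_norm v.
Proof.
rewrite /factor; case: ifP => _; last exact: l1_coord_le.
apply: le_trans (real_norm_sum _) _; apply: le_trans (l1_partial_sum (2 ^ level q) v).
by apply: ler_sum => t _; rewrite real_normM real_norm_of_real walsh_norm mul1r.
Qed.

Definition walsh_form (v : 'I_m -> l1 R s) (q : nat) : K :=
  of_real s (rho ^+ level q) * \prod_i factor q i (v i).

Lemma walsh_form_le v q :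
  real_norm (walsh_form v q) <= rho ^+ level q * \prod_i real_norm (v i).
Proof.
rewrite real_normM real_norm_of_real ger0_norm ?exprn_ge0 ?(ltW rho_gt0)//.
rewrite ler_wpM2l ?exprn_ge0 ?(ltW rho_gt0)//.
rewrite (big_morph (fun z : K => real_norm z) (@real_normM R s) real_norm1).
by apply: ler_prod => i _; rewrite real_norm_ge0 factor_le.
Qed.

(** There are 2 ^ d coordinates of level d, each at most rho ^ d times the
    product of the norms, whence a geometric series of ratio 2 rho^2. *)
Lemma walsh_form_sum_le v :
  (\sum_(0 <= q <oo) (real_norm (walsh_form v q) ^+ 2)%:E <=
   ((\prod_i real_norm (v i)) ^+ 2 / (1 - 2 * rho ^+ 2))%:E)%E.
Proof.
apply: dyadic_series_le => [q|D]; first exact: sqr_ge0.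
set Q := \prod_i _.
apply: (@le_trans _ _ (\sum_(0 <= q < (2 ^ D).-1) Q ^+ 2 * (rho ^+ 2) ^+ level q)).
  apply: ler_sum => q _; have := walsh_form_le v q; rewrite -/Q => h.
  have -> : Q ^+ 2 * (rho ^+ 2) ^+ level q = (rho ^+ level q * Q) ^+ 2.
    by rewrite [RHS]exprMn exprAC mulrC.
  by rewrite lerXn2r// nnegrE ?real_norm_ge0// (le_trans _ h)// real_norm_ge0.
rewrite -mulr_sumr ler_wpM2l ?sqr_ge0//.
rewrite (sum_dyadic (fun d _ => (rho ^+ 2) ^+ d)).
apply: le_trans (geometric_sum_le D _ rho_lt); last by rewrite mulr_ge0 ?sqr_ge0.
apply: ler_sum => d _; rewrite sumr_const card_ord -[_ *+ (2 ^ d)]mulr_natl natrX.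
by rewrite [leRHS]exprMn.
Qed.

Lemma walsh_form_l2 v : walsh_form v \in lp_seq (ler1n R 2).
Proof.
apply/asboolP; rewrite unlock.
under eq_eseriesr => q _ do rewrite powR_mulrn ?real_norm_ge0//.
by apply: le_lt_trans (walsh_form_sum_le v) _; exact: ltry.
Qed.

Definition walsh_operator (v : 'I_m -> l1 R s) : l2 R s := Lp (walsh_form_l2 v).

Lemma walsh_operator_bounded : bounded_multilinear walsh_operator.
Proof.
split.
  move=> v i a u w; apply: val_inj; apply/funext => q.
  transitivity (a * walsh_form (dfwith v i u) q + walsh_form (dfwith v i w) q); last by [].
  transitivity (walsh_form (dfwith v i (a *: u + w)) q); first by [].
  have E y : walsh_form (dfwith v i y) q = factor q i y *
      (of_real s (rho ^+ level q) * \prod_(i' | i' != i) factor q i' (v i')).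
    rewrite /walsh_form (bigD1 i)//= dfwithin mulrCA; congr (_ * (_ * _)).
    by apply: eq_bigr => i' ii'; rewrite dfwithout// eq_sym.
  by rewrite !E factor_linear mulrDl -mulrA.
exists (Num.sqrt (1 - 2 * rho ^+ 2)^-1) => v.
have h : 0 < 1 - 2 * rho ^+ 2 by rewrite subr_gt0.
have Q0 : 0 <= \prod_i real_norm (v i) by rewrite prodr_ge0// => i _; exact: real_norm_ge0.
rewrite -(ler_pXn2r (n := 2)) ?nnegrE ?real_norm_ge0 ?mulr_ge0 ?sqrtr_ge0//.
rewrite exprMn sqr_sqrtr ?invr_ge0 ?(ltW h)// mulrC -lee_fin l2_normE.
exact: walsh_form_sum_le.
Qed.

Definition walsh_vector (q : nat) : l1 R s :=
  of_real s (rho ^+ level q / 2 ^+ level q) *: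
  \sum_(t < 2 ^ level q) of_real s (walsh (level q) (offset q) t) *: unit_vector t.

Definition test_sequence (i : 'I_m) (q : nat) : l1 R s :=
  if i \in B then walsh_vector q else if q == 0%N then unit_vector 0 else 0.

Lemma dyadic_weakly_summable (x : nat -> l1 R s) (c : R) :
  (forall phi, @dual_unit_ball R s (l1 R s) phi -> forall D,
     \sum_(0 <= q < (2 ^ D).-1) real_norm (phi (x q)) <= c) ->
  weakly_summable x.
Proof.
move=> H; apply: (@le_lt_trans _ _ c%:E); last exact: ltry.
apply: ge_ereal_sup => _ [phi phi1 <-]; apply: dyadic_series_le.
  by move=> q; exact: real_norm_ge0.
exact: H.
Qed.

(** Level d contributes at most rho^d 2^-d times the norm of the Walsh matrix,
    that is (rho sqrt 2)^d. *)
Lemma test_sequence_weakly_summable i : weakly_summable (test_sequence i).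
Proof.
rewrite /test_sequence; case: (i \in B); last first.
  apply: (@dyadic_weakly_summable _ 1) => phi phi1 D.
  case: (2 ^ D).-1 => [|n]; first by rewrite big_geq.
  rewrite big_nat_recl//= big1 ?addr0.
    by apply: le_trans (phi1 _) _; rewrite real_norm_unit_vector.
  by move=> q _; rewrite linear0 real_norm0.
pose a := rho * Num.sqrt 2.
have a0 : 0 <= a by rewrite mulr_ge0 ?sqrtr_ge0 ?(ltW rho_gt0).
have a1 : a < 1.
  rewrite -(ltr_pXn2r (n := 2)) ?nnegrE// expr1n /a exprMn sqr_sqrtr//.
  by rewrite mulrC.
apply: (@dyadic_weakly_summable _ (1 - a)^-1) => phi phi1 D.
pose F d u : R := rho ^+ d / 2 ^+ d *
  real_norm (\sum_(t < 2 ^ d) of_real s (walsh d u t) * (phi (unit_vector t) : K)).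
rewrite (eq_bigr (fun q => F (level q) (offset q))); last first.
  move=> q _; rewrite /walsh_vector linearZ linear_sum /F.
  transitivity (real_norm (of_real s (rho ^+ level q / 2 ^+ level q) *
    (\sum_(t < 2 ^ level q) of_real s (walsh (level q) (offset q) t) *
       (phi (unit_vector t) : K)) : K)).
    congr (real_norm (_ * _)); apply: eq_bigr => t _; by rewrite linearZ.
  rewrite real_normM real_norm_of_real ger0_norm// divr_ge0 ?exprn_ge0 ?(ltW rho_gt0)//.
rewrite sum_dyadic; apply: le_trans (geometric_sum_le D a0 a1).
apply: ler_sum => d _; rewrite /F -mulr_sumr.
have W := @walsh_sum_le R s d (fun t => (phi (unit_vector t) : K)).
apply: le_trans (ler_wpM2l _ (W _)) _.
- by rewrite divr_ge0 ?exprn_ge0 ?(ltW rho_gt0).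
- by move=> t; apply: le_trans (phi1 _) _; rewrite real_norm_unit_vector.
by rewrite mulrA divfK ?expf_neq0// /a exprMn.
Qed.

(** The scaling 2^-d of the test vector compensates the squared norm 2^d of a row
    of the Walsh matrix. *)
Lemma walsh_coefficient_vector q :
  walsh_coefficient q (walsh_vector q) = of_real s (rho ^+ level q).
Proof.
set d := level q; set u := offset q.
have E (t : 'I_(2 ^ d)) : coord (walsh_vector q) t =
    of_real s (rho ^+ d / 2 ^+ d) * of_real s (walsh d u t).
  rewrite /walsh_vector lp_funZ lp_fun_sum; congr (_ * _).
  under eq_bigr => k _ do rewrite lp_funZ unit_vectorE.
  rewrite (bigD1 t)//= eqxx mulr1 big1 ?addr0// => k kt.
  by rewrite eq_sym (inj_eq val_inj) (negPf kt) mulr0.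
rewrite /walsh_coefficient -/d -/u.
rewrite (eq_bigr (fun=> of_real s (rho ^+ d / 2 ^+ d))).
  rewrite sumr_const card_ord -[_ *+ (2 ^ d)]mulr_natl natrX.
  have -> : (2 : K) = of_real s 2 by rewrite of_realD of_real1.
  by rewrite -of_realX -of_realM mulrC divfK ?expf_neq0.
by move=> t _; rewrite E mulrCA -of_realM walsh_sqr of_real1 mulr1.
Qed.

(** The coordinate q alone gives the bound: one factor rho ^ level q from the
    operator and one from each argument in B. *)
Lemma walsh_operator_test q :
  rho ^+ (level q * #|B|.+1) <=
  real_norm (walsh_operator (fun i => test_sequence i (if i \in B then q else 0%N))).
Proof.
apply: le_trans (l2_coord_le _ q).
rewrite -[coord2 _ q]/(walsh_form _ q) /walsh_form.
rewrite (bigID (mem B))/= [X in _ * (_ * X)]big1 ?mulr1; last first.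
  by move=> i /negPf iB; rewrite /factor /test_sequence iB.
rewrite (eq_bigr (fun=> of_real s (rho ^+ level q))); last first.
  by move=> i iB; rewrite /factor /test_sequence iB walsh_coefficient_vector.
rewrite prodr_const -exprS -of_realX real_norm_of_real exprM.
by rewrite ger0_norm// !exprn_ge0// ltW.
Qed.

End optimality.

Section sharpness.
Context {R : realType} {s : scalar_kind} {m k : nat}.

(** With rho^(d(n+1)r) = 2^-d, the 2^d indices of level d contribute at least 1.
    They form a subset of Omega: the coordinates in the block l0 carry the index,
    and all other blocks carry 0. *)
Lemma not_abs_summing (I : 'I_k -> {set 'I_m}) (l0 : 'I_k) (r : R) :
  (forall l l', l != l' -> [disjoint I l & I l']) ->
  (0 < #|I l0|)%N -> 0 < r -> r < 2 / (#|I l0|%:R + 1) ->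
  exists T : ('I_m -> l1 R s) -> l2 R s,
    bounded_multilinear T /\ ~ abs_summing I r T.
Proof.
move=> Idisj B0 r0 rn; set B := I l0; set n1 : R := #|B|%:R + 1.
have n10 : 0 < n1 by rewrite ltr_wpDl.
pose e := (n1 * r)^-1.
have e0 : 0 < e by rewrite invr_gt0 mulr_gt0.
have e12 : 1 < e * 2.
  rewrite -(ltr_pM2l (mulr_gt0 n10 r0)) mulr1 mulrA mulfV ?mul1r ?gt_eqF ?mulr_gt0//.
  by rewrite mulrC -ltr_pdivlMr.
pose rho : R := 2 `^ (- e).
have rho0 : 0 < rho by rewrite powR_gt0.
have rho1 : 2 * rho ^+ 2 < 1.
  rewrite -powR_mulrn ?powR_ge0// -powRrM -[X in X * _ < _]powRr1// -powRD; last by rewrite pnatr_eq0 implybT.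
  rewrite (_ : 1 + - e * 2 = - (e * 2 - 1)); last by ring.
  rewrite powRN invf_lt1 ?powR_gt0//.
  suff : 1 `^ (e * 2 - 1) < 2 `^ (e * 2 - 1) :> R by rewrite powR1.
  by rewrite gt0_ltr_powR ?nnegrE ?ltr1n// subr_gt0.
have rho_level d : (rho ^+ (d * #|B|.+1)) `^ r = (2 ^+ d)^-1.
  rewrite -!powR_mulrn ?powR_ge0// -!powRrM -powRN; congr (_ `^ _).
  rewrite natrM -natr1 -/n1 /e; field; by rewrite !gt_eqF.
exists (walsh_operator B rho0 rho1); split; first exact: walsh_operator_bounded.
move=> [_ /(_ _ (test_sequence_weakly_summable B rho0 rho1))].
set S := (X in (X < _)%E) => Soo.
pose h q : {ffun 'I_m -> nat} := [ffun i => if i \in B then q else 0%N].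
have [a aB] : exists a, a \in B by exact/card_gt0P.
have hinj : injective h by move=> q q' /ffunP/(_ a); rewrite !ffunE aB.
have SD D : (D%:R%:E <= S)%E.
  pose X := [set h q | q in `I_((2 ^ D).-1)]%classic.
  have hO q : Omega I (h q).
    move=> l a1 a2 a1l a2l; rewrite !ffunE.
    have [e1|ll0] := eqVneq l l0; first by rewrite /B -e1 a1l a2l.
    have Ndisj a' : a' \in I l -> (a' \in B) = false.
      by move=> a'l; exact: (disjointFr (Idisj _ _ ll0) a'l).
    by rewrite !Ndisj.
  apply: esum_ge; exists X.
    split; first by apply: finite_image; exact: finite_II.
    by move=> _ [q _ <-]; exact: hO.
  rewrite fsbig_image//; last by move=> q q' _ _; exact: hinj.
  rewrite -fsbig_ord sumEFin lee_fin.
  apply: (@le_trans _ _ (\sum_(0 <= q < (2 ^ D).-1) (2 ^+ level q)^-1)).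
    rewrite (sum_dyadic (fun d _ => (2 ^+ d)^-1)).
    rewrite (eq_bigr (fun=> 1)); first by rewrite sumr_const card_ord.
    move=> d _; rewrite sumr_const card_ord -[_ *+ (2 ^ d)]mulr_natl natrX mulfV//.
  rewrite big_mkord; apply: ler_sum => q _; rewrite -rho_level.
  rewrite ge0_ler_powR ?nnegrE ?exprn_ge0 ?real_norm_ge0 ?(ltW r0) ?(ltW rho0)//.
  have -> : (fun i => test_sequence B rho i (h q i)) =
      (fun i => test_sequence B rho i (if i \in B then (q : nat) else 0%N)) :> ('I_m -> l1 R s).
    by apply/funext => i; rewrite ffunE.
  exact: walsh_operator_test.
have S0 : (0 <= S)%E by exact: (SD 0%N).
have := SD (Num.bound (fine S)).
rewrite -(@fineK _ S) ?ge0_fin_numE// lee_fin.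
by rewrite leNgt archi_boundP// fine_ge0.
Qed.

End sharpness.

(** * The theorem *)

Section min_block_theory.
Variables (m k : nat) (I : 'I_k -> {set 'I_m}).

Lemma min_block_le l : (min_block I <= #|I l|)%N.
Proof.
rewrite /min_block; have := mem_index_enum l.
elim: (index_enum _) => [//|l' r IHr]; rewrite in_cons big_cons geq_min.
by case/orP => [/eqP ->|/IHr ->]; rewrite ?leqnn ?orbT.
Qed.

Lemma min_block_attained : (0 < k)%N -> exists l, #|I l| = min_block I.
Proof.
move=> k0; have lt_or : (exists l, #|I l| = min_block I) \/ min_block I = m.
  rewrite /min_block; elim: (index_enum _) => [|l r IHr]; first by right; rewrite big_nil.
  rewrite big_cons /minn; case: ifP => _; last exact: IHr.
  by left; exists l.
case: lt_or => // e; exists (Ordinal k0); apply/eqP; rewrite eqn_leq min_block_le andbT.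
by rewrite e -[X in (_ <= X)%N]card_ord max_card.
Qed.

End min_block_theory.

Theorem corollary4p6 (R : realType) (s : scalar_kind) (m k : nat)
    (m_gt0 : (0 < m)%N) (k_gt0 : (1 <= k)%N) (k_le_m : (k <= m)%N)
    (I : 'I_k -> {set 'I_m})
    (I_nonvoid : forall l, I l != finset.set0)
    (I_disjoint : forall l l', l != l' -> [disjoint I l & I l'])
    (I_cover : (\bigcup_(l < k) I l)%SET = [set: 'I_m]%SET) :
  let n := min_block I in
  @bounded_multilinear R s m (l1 R s) (l2 R s) =
    @abs_summing R s m k I (2 / (n%:R + 1)) (l1 R s) (l2 R s) /\
  forall r : R, 0 < r -> r < 2 / (n%:R + 1) ->
    @bounded_multilinear R s m (l1 R s) (l2 R s) <>
      @abs_summing R s m k I r (l1 R s) (l2 R s).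
Proof.
move=> n; have [l0 l0n] := min_block_attained I k_gt0.
have In l : (0 < #|I l|)%N by rewrite card_gt0.
split.
  apply/seteqP; split => T; last by case.
  apply: bounded_multilinear_summing => //; first by rewrite /n -l0n.
  exact: min_block_le.
move=> r r0; rewrite /n -l0n => rn eq_spaces.
have [T [Tb nT]] := @not_abs_summing R s m k I l0 r I_disjoint (In l0) r0 rn.
by apply: nT; rewrite -eq_spaces.
Qed.
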